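(* Suppose $0<r\le d$ and $0<\delta\le\delta^*$. Then there is a number $k^*>K$ satisfying the equation $$\left(\frac{k^{*}}{K}\right)^{\frac{2\lambda}{\sigma}}\left(-2\left(\frac{K}{k^{*}}\right)^{\kappa+\frac{\lambda}{\sigma}}\delta\lambda+(k^{*}-K)\left(\lambda-\kappa\sigma+\left(\frac{K}{k^{*}}\right)^{\frac{2\lambda}{\sigma}}(\lambda+\kappa\sigma)\right)\right)=k^{*}\left(-1+\left(\frac{k^{*}}{K}\right)^{\frac{2\lambda}{\sigma}}\right)\sigma$$ such that the perpetual $\delta$-penalty call option has value process $V(X_t)$, i.e. $V^*(x)=V(x)$ for all $x>0$, where $$V(x)=\begin{cases}x-K & \text{if } x\in[k^*,\infty),\\[4pt] (k^{*}-K)\left(\frac{k^{*}}{x}\right)^{\kappa}\dfrac{\left(\frac{K}{x}\right)^{-\frac{\lambda}{\sigma}}-\left(\frac{K}{x}\right)^{\frac{\lambda}{\sigma}}}{\left(\frac{k^{*}}{K}\right)^{\frac{\lambda}{\sigma}}-\left(\frac{k^{*}}{K}\right)^{-\frac{\lambda}{\sigma}}}+\delta\left(\frac{K}{x}\right)^{\kappa}\dfrac{\left(\frac{k^{*}}{x}\right)^{\frac{\lambda}{\sigma}}-\left(\frac{k^{*}}{x}\right)^{-\frac{\lambda}{\sigma}}}{\left(\frac{k^{*}}{K}\right)^{\frac{\lambda}{\sigma}}-\left(\frac{k^{*}}{K}\right)^{-\frac{\lambda}{\sigma}}} & \text{if } x\in(K,k^* ),\\[4pt] \delta\left(\frac{x}{K}\right)^{\frac{\lambda}{\sigma}-\kappa}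 & \text{if } x\in(0,K],\end{cases}$$ and the optimal exercise strategy (holder) and cancellation strategy (writer) are, respectively, $\rho^*:=\inf\{t\ge0: X_t\ge k^*\}$ and $\tau^*:=\inf\{t\ge 0: X_t=K\}$.
   Context: Setting. $r>0$ (interest rate), $d\ge0$ (dividend rate), $\sigma>0$ (volatility), $K>0$ (strike), $\delta>0$ (penalty) are constants. $W$ is a standard Brownian motion under the probability measure $\mathbb P$, and the asset price is $X_t=xN_t$ with $X_0=x>0$, $N_t=\exp\{(r-d-\tfrac{\sigma^2}{2})t+\sigma W_t\}$, so $dX_t=(r-d)X_t\,dt+\sigma X_t\,dW_t$. $\mathcal S_{0,\infty}$ is the set of all $[0,\infty]$-valued stopping times of the Brownian filtration; $\inf\emptyset=\infty$; discounted payoffs at time $\infty$ are $0$. Perpetual $\delta$-penalty call option. If the holder exercises at the stopping time $\rho$ and the writer cancels at the stopping time $\tau$, the expected discounted payoff to the holder is $$J^x(\rho,\tau)=\mathbb E\big[e^{-r(\rho\wedge\tau)}\{((xN_\tau-K)^++\delta)1_{\{\tau<\rho\}}+(xN_\rho-K)^+1_{\{\rho\le\tau\}}\}\big].$$ The value of the option is $V^*(x)=\inf_{\tau\in\mathcal S_{0,\infty}}\sup_{\rho\in\mathcal S_{0,\infty}}J^x(\rho,\tau)=\sup_{\rho\in\mathcal S_{0,\infty}}\inf_{\tau\in\mathcal S_{0,\infty}}J^x(\rho,\tau)$ (the equality of the two expressions is a standard fact). Strategies $\rho^*,\tau^*$ are optimal if they form a saddle point: $J^x(\rho,\tau^* )\le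 J^x(\rho^*,\tau^* )\le J^x(\rho^*,\tau)$ for all $\rho,\tau\in\mathcal S_{0,\infty}$ and all $x>0$. Constants. $$\lambda=\sqrt{2r+\Big(\frac{r-d-\sigma^2/2}{\sigma}\Big)^2},\quad \kappa=\frac{r-d-\sigma^2/2}{\sigma^2},\quad b=\frac{\frac{\lambda}{\sigma}-\kappa}{\frac{\lambda}{\sigma}-\kappa-1}K,\quad \delta^*=(b-K)\left(\frac{K}{b}\right)^{\frac{\lambda}{\sigma}-\kappa}.$$ Here $\delta^*=v^c(K)$, where $v^c(x)=\sup_{\rho\in\mathcal S_{0,\infty}}\mathbb E[e^{-r\rho}(xN_\rho-K)^+]$ is the value of the perpetual American call. *)

(* Defs.v *)
From HB Require Import structures.
From mathcomp Require Import all_boot all_order all_algebra.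
From mathcomp Require Import all_classical all_reals all_analysis.

Set Implicit Arguments.
Unset Strict Implicit.
Unset Printing Implicit Defensive.

Import Order.TTheory GRing.Theory Num.Theory.
Import numFieldNormedType.Exports.

Local Open Scope classical_set_scope.
Local Open Scope ring_scope.

(* Time is real-valued; a process is only ever used at times [t >= 0]. *)

Definition natural_generators (R : realType) (disp : measure_display)
    (T : measurableType disp) (P : probability T R) (W : R -> {RV P >-> R})
    (t : R) : set (set T) :=
  \bigcup_(s in `[0, t]) preimage_set_system setT (W s) measurable.

Definition null_sets (R : realType) (disp : measure_display)
    (T : measurableType disp) (P : probability T R) : set (set T) :=
  [set A | measurable A /\ P A = 0%E].

(* Standard Brownian motion on [0, oo[: started at 0, all paths continuous,
   [W t - W s] independent of [sigma(W u, u <= s)] and distributed as N(0, t-s);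
   the second parameter of [normal_prob] is the standard deviation. *)
Definition brownian_motion (R : realType) (disp : measure_display)
    (T : measurableType disp) (P : probability T R)
    (W : R -> {RV P >-> R}) : Prop :=
  [/\ forall w, W 0 w = 0,
      forall w, {within `[0, +oo[, continuous (fun t : R => W t w)},
      forall s t : R, 0 <= s -> s < t -> forall B : set R, measurable B ->
        P ((W t \- W s) @^-1` B) = normal_prob 0 (Num.sqrt (t - s)) B
    & forall s t : R, 0 <= s -> s < t ->
        forall A : set T, <<s natural_generators W s >> A ->
        forall B : set R, measurable B ->
          P (A `&` (W t \- W s) @^-1` B)
            = (P A * P ((W t \- W s)%R @^-1` B))%E].

(* Augmentation of the natural filtration by the null events of [P]; the
   usual augmentation when [P] is complete, which need not be assumed. *)
Definition brownian_filtration (R : realType) (disp : measure_display)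
    (T : measurableType disp) (P : probability T R) (W : R -> {RV P >-> R})
    (t : R) : set (set T) :=
  <<s natural_generators W t `|` null_sets P >>.

Definition stopping_times (R : realType) (disp : measure_display)
    (T : measurableType disp) (P : probability T R)
    (W : R -> {RV P >-> R}) : set (T -> \bar R) :=
  [set tau | (forall w, (0 <= tau w)%E) /\
     forall t : R, 0 <= t ->
       brownian_filtration W t [set w | (tau w <= t%:E)%E]].

Definition stock (R : realType) (disp : measure_display)
    (T : measurableType disp) (P : probability T R) (W : R -> {RV P >-> R})
    (r d sigma x t : R) (w : T) : R :=
  x * expR ((r - d - sigma ^+ 2 / 2) * t + sigma * W t w).

Definition hitting_time (R : realType) (T : Type) (X : R -> T -> R)
    (A : set R) (w : T) : \bar R :=
  ereal_inf [set t%:E | t in [set t : R | 0 <= t /\ A (X t w)]].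

Definition call (R : realType) (K y : R) : R := Num.max (y - K) 0.

(* Nothing is paid when both players never stop. *)
Definition discounted_payoff (R : realType) (disp : measure_display)
    (T : measurableType disp) (P : probability T R) (W : R -> {RV P >-> R})
    (r d sigma K delta x : R) (rho tau : T -> \bar R) (w : T) : R :=
  if mine (rho w) (tau w) is EFin t then
    expR (- (r * t)) *
      (if (tau w < rho w)%E then call K (stock W r d sigma x t w) + delta
       else call K (stock W r d sigma x t w))
  else 0.

Definition J (R : realType) (disp : measure_display)
    (T : measurableType disp) (P : probability T R) (W : R -> {RV P >-> R})
    (r d sigma K delta x : R) (rho tau : T -> \bar R) : \bar R :=
  ('E_P[discounted_payoff W r d sigma K delta x rho tau])%E.

Definition upper_value (R : realType) (disp : measure_display)
    (T : measurableType disp) (P : probability T R) (W : R -> {RV P >-> R})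
    (r d sigma K delta x : R) : \bar R :=
  ereal_inf [set ereal_sup [set J W r d sigma K delta x rho tau
                              | rho in stopping_times W]
               | tau in stopping_times W].

Definition lower_value (R : realType) (disp : measure_display)
    (T : measurableType disp) (P : probability T R) (W : R -> {RV P >-> R})
    (r d sigma K delta x : R) : \bar R :=
  ereal_sup [set ereal_inf [set J W r d sigma K delta x rho tau
                              | tau in stopping_times W]
               | rho in stopping_times W].

(* The strategies are indexed by the initial price [x], since they are
   functionals of the price process started at [x]. *)
Definition optimal_strategies (R : realType) (disp : measure_display)
    (T : measurableType disp) (P : probability T R) (W : R -> {RV P >-> R})
    (r d sigma K delta : R) (rho0 tau0 : R -> T -> \bar R) : Prop :=
  forall x : R, 0 < x ->
    [/\ stopping_times W (rho0 x), stopping_times W (tau0 x) &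
      forall rho tau, stopping_times W rho -> stopping_times W tau ->
        (J W r d sigma K delta x rho (tau0 x)
           <= J W r d sigma K delta x (rho0 x) (tau0 x))%E /\
        (J W r d sigma K delta x (rho0 x) (tau0 x)
           <= J W r d sigma K delta x (rho0 x) tau)%E].

Definition lambda (R : realType) (r d sigma : R) : R :=
  Num.sqrt (2 * r + ((r - d - sigma ^+ 2 / 2) / sigma) ^+ 2).

Definition kappa (R : realType) (r d sigma : R) : R :=
  (r - d - sigma ^+ 2 / 2) / sigma ^+ 2.

Definition call_boundary (R : realType) (r d sigma K : R) : R :=
  let beta := lambda r d sigma / sigma - kappa r d sigma in
  beta / (beta - 1) * K.

Definition delta_star (R : realType) (r d sigma K : R) : R :=
  let b := call_boundary r d sigma K in
  (b - K) * (K / b) `^ (lambda r d sigma / sigma - kappa r d sigma).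

Definition kstar_equation (R : realType) (r d sigma K delta k : R) : Prop :=
  let l := lambda r d sigma in
  let kap := kappa r d sigma in
  (k / K) `^ (2 * l / sigma) *
    (- 2 * (K / k) `^ (kap + l / sigma) * delta * l +
     (k - K) * (l - kap * sigma + (K / k) `^ (2 * l / sigma) * (l + kap * sigma)))
  = k * (- 1 + (k / K) `^ (2 * l / sigma)) * sigma.

(* Only meant for [0 < x]. *)
Definition value_function (R : realType) (r d sigma K delta k x : R) : R :=
  let a := lambda r d sigma / sigma in
  let kap := kappa r d sigma in
  if k <= x then x - K
  else if K < x then
    (k - K) * (k / x) `^ kap *
      (((K / x) `^ (- a) - (K / x) `^ a) / ((k / K) `^ a - (k / K) `^ (- a))) +
    delta * (K / x) `^ kap *
      (((k / x) `^ a - (k / x) `^ (- a)) / ((k / K) `^ a - (k / K) `^ (- a)))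
  else delta * (x / K) `^ (a - kap).

(* Main.v *)
(* Along [X], the process [exp (- r t) X_t ^ p] is an exponential martingale
   exactly for the two roots [beta > 1] and [gamma < 0] of the characteristic
   equation. Hence each combination [f y = A y ^ beta + B y ^ gamma] satisfies
   [E (exp (- r S) f (X_S)) = f x] at every bounded stopping time [S], and no
   stochastic calculus is needed: it suffices to find, for each initial price
   [x], one such [f] with [f x = V x] which lies above the payoffs that can occur
   before the price reaches [K] (then the writer's strategy yields at most
   [V x]), and one which lies below the payoffs that can occur before the price
   reaches [k] (then the holder's strategy yields at least [V x]).

   For [x <= K] the multiple of [y ^ beta] with value [delta] at [K] serves both
   purposes. The other functions are tangents of [y - K], i.e. combinations of
   the two powers touching [y - K] at some [y0]: on [K, k] the value function is
   the tangent at [k], where [k] is chosen such that this tangent takes the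
   value [delta] at [K], and above [k] one uses the tangent at [x] itself. The
   inequalities follow from the monotonicity of the tangents in [y0], which
   holds because [r <= d], i.e. [beta + gamma >= 1]. *)

From HB Require Import structures.
From mathcomp Require Import all_boot all_order all_algebra.
From mathcomp Require Import all_classical all_reals all_analysis.
From mathcomp Require Import measurable_realfun ring lra.
Require Import Defs.

Set Implicit Arguments.
Unset Strict Implicit.
Unset Printing Implicit Defensive.

Import Order.TTheory GRing.Theory Num.Theory.
Import numFieldNormedType.Exports.

Local Open Scope classical_set_scope.
Local Open Scope ring_scope.

(** * The exponential martingale of Brownian motion *)

(** The Radon-Nikodym derivative and [normal_pdf] have the same integral over every measurable set,
    hence agree almost everywhere. *)
Lemma ge0_integral_normal_prob (R : realType) (m s : R) (f : R -> \bar R) :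
  measurable_fun setT f -> (forall x, 0 <= f x)%E ->
  (\int[normal_prob m s]_x f x =
   \int[lebesgue_measure]_x (f x * (normal_pdf m s x)%:E))%E.
Proof.
move=> mf f0.
have dom := @normal_prob_dominates R m s.
rewrite -(Radon_Nikodym_SigmaFinite.change_of_variables dom f0 measurableT mf).
have mpdf : measurable_fun setT (EFin \o normal_pdf m s).
  by apply/measurable_EFinP; exact: measurable_normal_pdf.
apply: ae_eq_integral => //.
- apply: emeasurable_funM => //.
  exact: measurable_int (Radon_Nikodym_SigmaFinite.f_integrable dom).
- exact: emeasurable_funM.
- apply: ae_eqe_mul2l; apply: integral_ae_eq => //.
  + exact: Radon_Nikodym_SigmaFinite.f_integrable dom.
  + by move=> E _ mE; rewrite -Radon_Nikodym_SigmaFinite.f_integral.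
Qed.

(** Completing the square turns [expR (a * x)] times the centred density into a constant times the
    density with mean [a * s ^+ 2]. *)
Lemma normal_mgf (R : realType) (s a : R) : s != 0 ->
  (\int[normal_prob 0 s]_x (expR (a * x))%:E =
   (expR (a ^+ 2 * s ^+ 2 / 2))%:E)%E.
Proof.
move=> s0.
rewrite ge0_integral_normal_prob; last 2 first.
- apply/measurable_EFinP; apply: measurableT_comp => //.
- by move=> x; rewrite lee_fin expR_ge0.
transitivity (\int[lebesgue_measure]_x
    ((expR (a ^+ 2 * s ^+ 2 / 2))%:E * (normal_pdf (a * s ^+ 2) s x)%:E))%E.
  apply: eq_integral => x _.
  rewrite -!EFinM !normal_pdfE // mulrCA [in RHS]mulrCA; congr (_ * _)%:E.
  by rewrite /normal_fun -!expRD; congr expR; rewrite -mulr_natr; field.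
rewrite ge0_integralZl_EFin ?expR_ge0//.
- by rewrite integral_normal_pdf mule1.
- by move=> x _; rewrite lee_fin normal_pdf_ge0.
- by apply/measurable_EFinP; exact: measurable_normal_pdf.
Qed.

Section gaussian_law.
Context (R : realType).

(* [normal_prob] lives on [measurableTypeR R], random variables take their
   values in [R]: two distinct structures for the same Borel sets. *)
Let idR : measurableTypeR R -> R := idfun.
HB.instance Definition _ :=
  @isMeasurableFun.Build _ _ _ _ idR (@measurable_id _ _ setT).

Lemma gaussian_law_mgf (mu : {measure set R -> \bar R}) (s a : R) : s != 0 ->
  (forall B : set R, measurable B -> mu B = normal_prob 0 s B) ->
  (\int[mu]_x (expR (a * x))%:E = (expR (a ^+ 2 * s ^+ 2 / 2))%:E)%E.
Proof.
move=> s0 law; rewrite -normal_mgf //.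
transitivity (\int[distribution (normal_prob 0 s) idR]_x (expR (a * x))%:E)%E.
  by apply: eq_measure_integral => B mB _; exact: law.
rewrite ge0_integral_distribution //.
by apply/measurable_EFinP; apply: measurableT_comp.
Qed.

End gaussian_law.

Section independent_factor.
Context (R : realType) (disp : measure_display) (T : measurableType disp).
Variables (P : probability T R) (G : set (set T)) (D : {RV P >-> R}).
Hypothesis Gmeas : <<s G >> `<=` measurable.
Hypothesis indep : forall A, <<s G >> A -> forall B, measurable B ->
  P (A `&` D @^-1` B) = (P A * P (D @^-1` B))%E.

Let gT := g_sigma_algebraType G.
Let idG : T -> gT := id.
Let midG : measurable_fun setT idG.
Proof. by move=> _ B mB; rewrite setTI; exact: Gmeas. Qed.
HB.instance Definition _ := isMeasurableFun.Build _ _ _ _ idG midG.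

Let joint : T -> gT * R := fun w => (idG w, D w).
Let mjoint : measurable_fun setT joint.
Proof. exact/measurable_fun_pairP. Qed.
HB.instance Definition _ := isMeasurableFun.Build _ _ _ _ joint mjoint.

(** By [indep], the joint law of the identity on [gT] and [D] is the product of the marginals, and
    Tonelli factors the integral. [gT] is [T] with the sigma-algebra generated by [G], so that [Y]
    ranges over the variables known to [G]. *)
Lemma ge0_expectation_indepM (Y : gT -> R) (g : R -> R) :
  measurable_fun setT Y -> (forall w, 0 <= Y w) ->
  measurable_fun setT g -> (forall x, 0 <= g x) ->
  (\int[P]_w (Y w * g (D w))%:E =
   (\int[P]_w (Y w)%:E) * \int[distribution P D]_x (g x)%:E)%E.
Proof.
move=> mY Y0 mg g0.
pose f (z : gT * R) := (Y z.1 * g z.2)%:E.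
have mf : measurable_fun setT f.
  apply/measurable_EFinP; apply: measurable_funM.
    by apply: measurableT_comp mY _; exact: measurable_fst.
  by apply: measurableT_comp mg _; exact: measurable_snd.
have f0 z : (0 <= f z)%E by rewrite lee_fin mulr_ge0.
transitivity (\int[distribution P joint]_z f z)%E.
  by rewrite ge0_integral_distribution.
transitivity (\int[distribution P idG \x distribution P D]_z f z)%E.
  apply: eq_measure_integral => A mA _; apply/esym.
  by apply: product_measure_unique => // B C mB mC; exact: indep.
rewrite fubini_tonelli1 //.
transitivity (\int[distribution P idG]_w
    ((Y w)%:E * \int[distribution P D]_x (g x)%:E))%E.
  apply: eq_integral => w _; rewrite /fubini_F /f /=.
  under eq_integral do rewrite EFinM.
  rewrite ge0_integralZl_EFin //; last exact/measurable_EFinP.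
  by move=> x _; rewrite lee_fin.
rewrite ge0_integralZr //=.
- congr (_ * _)%E; rewrite ge0_integral_distribution //.
  exact/measurable_EFinP.
- exact/measurable_EFinP.
- by move=> w _; rewrite lee_fin.
- by apply: integral_ge0 => x _; rewrite lee_fin.
Qed.

End independent_factor.

Section null_sets.
Context (R : realType) (disp : measure_display) (T : measurableType disp).
Variable P : probability T R.

Lemma measureI_eq_mod0 (A A' N E : set T) :
  measurable A -> measurable A' -> measurable E -> measurable N ->
  P N = 0%E -> A `\` N = A' `\` N -> P (A `&` E) = P (A' `&` E).
Proof.
move=> mA mA' mE mN N0 AA'.
have key (B : set T) : measurable B -> P (B `&` E) = P ((B `\` N) `&` E).
  move=> mB; have mBE : measurable (B `&` E) by exact: measurableI.
  have z : P (B `&` E `&` N) = 0%E.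
    apply/eqP; rewrite eq_le measure_ge0 andbT -N0.
    by apply: le_measure; rewrite ?inE //; exact: measurableI.
  have e : P (B `&` E) = (P (B `&` E `\` N) + P (B `&` E `&` N))%E.
    exact: measureDI.
  by rewrite e z adde0 setIC -setIDA setIC.
by rewrite key // AA' -key.
Qed.

(** The events that agree with one of [<<s G>>] off a null event form a sigma-algebra containing
    both kinds of generators. This carries independence over from the natural filtration to the
    augmented one. *)
Lemma sigma_algebra_null_sets (G : set (set T)) (A : set T) :
  <<s G >> `<=` measurable -> <<s G `|` null_sets P >> A ->
  exists A' N, [/\ <<s G >> A', measurable N, P N = 0%E &
    A `\` N = A' `\` N].
Proof.
move=> Gm; move: A; apply: smallest_sub.
- split.
  + by exists set0, set0; split=> //; exact: sigma_algebra0.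
  + move=> A [A' [N [GA' mN N0 AA']]]; exists (~` A'), N; split=> //.
      exact: sigma_algebraC.
    rewrite setTD; move/seteqP: AA' => [s1 s2].
    apply/seteqP; split=> w [/= nA nN];
      split=> // A'w.
      by apply: nA; case: (s2 w).
    by apply: nA; case: (s1 w).
  + move=> F /choice[F' /choice[N FN]].
    exists (\bigcup_k F' k), (\bigcup_k N k); split.
    * by apply: sigma_algebra_bigcup => k; case: (FN k).
    * by apply: bigcup_measurable => k _; case: (FN k).
    * apply/negligibleP.
        by apply: bigcup_measurable => k _; case: (FN k).
      by apply: negligible_bigcup => k; case: (FN k) => _ mN N0 _; exact/negligibleP.
    * apply/seteqP; split=> w [[k _ Fw] nN].
        split=> //; exists k => //; case: (FN k) => _ _ _ /seteqP[+ _].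
        by move=> /(_ w) []; [split => // Nw; apply: nN; exists k|].
      split=> //; exists k => //; case: (FN k) => _ _ _ /seteqP[_ +].
      by move=> /(_ w) []; [split => // Nw; apply: nN; exists k|].
- move=> A [GA|[mA A0]].
    by exists A, set0; split=> //; exact: sub_sigma_algebra.
  exists set0, A; split=> //; first exact: sigma_algebra0.
  by rewrite setDv set0D.
Qed.
End null_sets.

Section brownian.
Context (R : realType) (disp : measure_display) (T : measurableType disp).
Context (P : probability T R) (W : R -> {RV P >-> R}).

Lemma natural_generators_measurable (t : R) :
  natural_generators W t `<=` measurable.
Proof.
move=> A [s _ [B mB <-]]; exact: (measurable_funPT (W s)).
Qed.

Lemma natural_sigma_measurable (t : R) :
  <<s natural_generators W t >> `<=` measurable.
Proof.
apply: smallest_sub; last exact: natural_generators_measurable.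
exact: sigma_algebra_measurable.
Qed.

Lemma brownian_filtration_measurable (t : R) :
  brownian_filtration W t `<=` measurable.
Proof.
apply: smallest_sub; first exact: sigma_algebra_measurable.
by move=> A [/natural_generators_measurable //|[]].
Qed.

Lemma brownian_filtration_le (s t : R) : s <= t ->
  brownian_filtration W s `<=` brownian_filtration W t.
Proof.
move=> st; apply: sub_sigma_algebra2; apply: setSU.
move=> A [u us GA]; exists u => //.
by move: us; rewrite /= !in_itv /= => /andP[-> /le_trans->].
Qed.

Local Notation gF t := (g_sigma_algebraType (natural_generators W t `|` null_sets P)).

Lemma brownian_filtration_W (s t : R) : 0 <= s <= t ->
  measurable_fun setT (W s : gF t -> R).
Proof.
move=> st _ B mB; apply: sub_sigma_algebra; left.
by exists s; [rewrite /= in_itv|exists B].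
Qed.

(** The Wald martingale of [W] with parameter [a]. *)
Definition exp_martingale (a t : R) (w : T) : R :=
  expR (a * W t w - a ^+ 2 / 2 * t).

Lemma exp_martingale_ge0 a t w : 0 <= exp_martingale a t w.
Proof. exact: expR_ge0. Qed.

Lemma measurable_exp_martingale a t : measurable_fun setT (exp_martingale a t).
Proof.
apply: measurableT_comp => //; apply: measurable_funB => //.
exact: measurable_funM.
Qed.

Hypothesis hW : brownian_motion W.

(** Replacing [A] by an event of the natural filtration that agrees with it off a null event changes
    neither side. *)
Lemma brownian_increment_indep (s t : R) (A : set T) (B : set R) :
  0 <= s -> s < t -> brownian_filtration W s A -> measurable B ->
  P (A `&` (W t \- W s) @^-1` B) = (P A * P ((W t \- W s)%R @^-1` B))%E.
Proof.
move=> s0 st FA mB; have [_ _ _ ind] := hW.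
have mE : measurable ((W t \- W s) @^-1` B).
  by rewrite -[X in measurable X]setTI; exact: measurable_funB.
have [A' [N [GA' mN N0 AA']]] :=
  sigma_algebra_null_sets (@natural_sigma_measurable s) FA.
have mA := brownian_filtration_measurable FA.
have mA' := natural_sigma_measurable GA'.
rewrite (measureI_eq_mod0 mA mA' mE mN N0 AA') (ind _ _ s0 st _ GA' _ mB).
congr (_ * _)%E.
have := measureI_eq_mod0 mA mA' measurableT mN N0 AA'.
by rewrite !setIT.
Qed.

(** The martingale property, tested on events of time [s]: the value at [t] is the value at [s]
    times a function of the independent increment, and this function has mean 1 by the Gaussian
    moment generating function. *)
Lemma exp_martingale_setI a (s t : R) (A : set T) :
  0 <= s <= t -> brownian_filtration W s A ->
  (\int[P]_w (\1_A w * exp_martingale a t w)%:E =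
   \int[P]_w (\1_A w * exp_martingale a s w)%:E)%E.
Proof.
move=> /andP[s0]; rewrite le_eqVlt => /predU1P[-> //|st] FA.
have [_ _ law _] := hW.
pose g x := expR (a * x - a ^+ 2 / 2 * (t - s)).
pose Y : gF s -> R := fun w => \1_A w * exp_martingale a s w.
pose D : {RV P >-> R} := (W t \- W s)%R.
transitivity (\int[P]_w (Y w * g (D w))%:E)%E.
  apply: eq_integral => w _; rewrite /Y -mulrA; congr (_ * _)%:E.
  by rewrite /exp_martingale /g -expRD; congr expR; rewrite /D /=; ring.
have mY : measurable_fun setT Y.
  apply: measurable_funM.
    exact: (@measurable_indic _ (gF s) R setT A FA).
  apply: measurableT_comp => //; apply: measurable_funB => //.
  apply: measurable_funM => //; apply: brownian_filtration_W.
  by rewrite s0 lexx.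
rewrite (@ge0_expectation_indepM _ _ _ P _ D (@brownian_filtration_measurable s)) //.
- rewrite [X in (_ * X)%E](_ : _ = 1%E) ?mule1 //.
  rewrite (_ : 1%E = ((expR (- (a ^+ 2 / 2 * (t - s))))%:E *
     (expR (a ^+ 2 * Num.sqrt (t - s) ^+ 2 / 2))%:E)%E); last first.
    rewrite -EFinM -expRD sqr_sqrtr ?subr_ge0 ?ltW //.
    by rewrite -[LHS](congr1 EFin (@expR0 R)); congr (expR _)%:E; field.
  rewrite -(@gaussian_law_mgf _ (distribution P D) (Num.sqrt (t - s))); last 2 first.
  + by rewrite sqrtr_eq0 -ltNge subr_gt0.
  + by move=> B mB; exact: law.
  rewrite -ge0_integralZl_EFin ?expR_ge0 //.
  + by apply: eq_integral => x _; rewrite -EFinM -expRD addrC.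
  + by apply/measurable_EFinP; apply: measurableT_comp.
- by move=> A' FA' B mB; exact: brownian_increment_indep.
- by move=> w; rewrite mulr_ge0 ?exp_martingale_ge0.
- by apply: measurableT_comp => //; apply: measurable_funB.
- by move=> x; exact: expR_ge0.
Qed.

Lemma expectation_exp_martingale a (t : R) : 0 <= t ->
  (\int[P]_w (exp_martingale a t w)%:E = 1)%E.
Proof.
move=> t0; have FT : brownian_filtration W 0 setT.
  by rewrite -setC0; apply: sigma_algebraC; exact: sigma_algebra0.
have t00 : 0 <= (0 : R) <= t by rewrite lexx.
have [W0 _ _ _] := hW.
transitivity (\int[P]_w (\1_setT w * exp_martingale a t w)%:E)%E.
  by apply: eq_integral => w _; rewrite indicT mul1r.
rewrite (exp_martingale_setI a t00 FT).
transitivity (\int[P]_w (cst 1%E w))%E.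
  apply: eq_integral => w _.
  by rewrite indicT mul1r /exp_martingale W0 !mulr0 subr0 expR0.
rewrite integral_cst // mul1e; exact: probability_setT.
Qed.

End brownian.

(** * Optional stopping *)

Lemma within_continuous_cvg_seq (R : realType) (f : R -> R) (A : set R)
    (v : nat -> R) (l : R) :
  {within A, continuous f} -> A l -> (forall n, A (v n)) -> v @ \oo --> l ->
  f (v n) @[n --> \oo] --> f l.
Proof.
move=> /subspace_continuousP/(_ l) fA Al Av vl.
apply: (cvg_comp _ f _ (fA Al)) => U wU.
have : \forall n \near \oo, A (v n) -> U (v n) := vl _ wU.
by apply: (@filterS nat) => n; apply; exact: Av.
Qed.

Lemma measurable_fun_select (d d' : measure_display) (T : measurableType d)
    (T' : measurableType d') (c : T -> nat) (f : nat -> T -> T') :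
  (forall i, measurable [set w | c w = i]) ->
  (forall i, measurable_fun setT (f i)) ->
  measurable_fun setT (fun w => f (c w) w).
Proof.
move=> mc mf _ B mB; rewrite setTI.
rewrite (_ : _ @^-1` _ = \bigcup_i ([set w | c w = i] `&` f i @^-1` B)).
  apply: bigcup_measurable => i _; apply: measurableI => //.
  by rewrite -[X in measurable X]setTI; apply: mf.
by apply/seteqP; split=> [w Bw|w [i _ [/= <-]] //]; exists (c w).
Qed.

Section optional_stopping.
Context (R : realType) (disp : measure_display) (T : measurableType disp).
Context (P : probability T R) (W : R -> {RV P >-> R}).
Hypothesis hW : brownian_motion W.

(** Optional stopping for a time with finitely many values: the expectation splits along the events
    [c = i], each of which is known at its own time [u i]. *)
Lemma expectation_exp_martingale_grid (a : R) (c : T -> nat) (u : nat -> R)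
    (L : nat) :
  (forall w, (c w <= L)%N) -> (forall i, (i <= L)%N -> 0 <= u i <= u L) ->
  (forall i, (i <= L)%N -> brownian_filtration W (u i) [set w | c w = i]) ->
  (\int[P]_w (exp_martingale W a (u (c w)) w)%:E = 1)%E.
Proof.
move=> cL uL Fc.
have mC i : measurable [set w | c w = i].
  have [iL|Li] := leqP i L.
    exact: brownian_filtration_measurable (Fc _ iL).
  rewrite (_ : [set _ | _] = set0) //; apply/seteqP; split=> // w /= ci.
  by have := cL w; rewrite ci leqNgt Li.
have split_sum (F : nat -> T -> R) :
    (forall i, measurable_fun setT (F i)) -> (forall i w, 0 <= F i w) ->
  (\int[P]_w (F (c w) w)%:E =
   \sum_(i < L.+1) \int[P]_w (\1_[set w | c w = i] w * F i w)%:E)%E.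
  move=> mF F0; rewrite -ge0_integral_sum //.
  - apply: eq_integral => w _; rewrite sumEFin; congr EFin.
    rewrite (bigD1 (Ordinal (cL w : (c w < L.+1)%N))) //= big1 => [|i ic].
      by rewrite addr0 indicE mem_set // mul1r.
    rewrite indicE memNset ?mul0r //= => ci; move/eqP: ic; apply.
    exact: val_inj.
  - move=> i; apply/measurable_EFinP; apply: measurable_funM => //.
  - by move=> i w _; rewrite lee_fin mulr_ge0.
have mM t := @measurable_exp_martingale _ _ _ _ W a t.
have M0 t w := @exp_martingale_ge0 _ _ _ _ W a t w.
rewrite (split_sum (fun i => exp_martingale W a (u i))) //.
have uL0 : 0 <= u L by have /andP[] := uL _ (leqnn L).
(* On [c = i], replace the time [u i] by the last time [u L]. *)
rewrite -(expectation_exp_martingale hW a uL0).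
rewrite (split_sum (fun=> exp_martingale W a (u L))) //.
apply: eq_bigr => -[i /= iL] _; apply/esym; apply: exp_martingale_setI => //.
  exact: uL.
exact: Fc.
Qed.

Variables (S : T -> R) (N : nat).
Hypothesis SN : forall w, 0 <= S w <= N%:R.
Hypothesis FS : forall t, 0 <= t -> brownian_filtration W t [set w | S w <= t].

(** [u m (c m w)] is [S w] rounded up to the grid of mesh [m.+1%:R^-1]. Rounding up keeps it a
    stopping time, since [c m w <= i] means [S w <= u m i]. *)
Let c (m : nat) (w : T) : nat := `|Num.ceil (S w * m.+1%:R)|%N.
Let u (m i : nat) : R := i%:R / m.+1%:R.

Let c_le m i w : (c m w <= i)%N = (S w <= u m i).
Proof.
rewrite /c -lez_nat gez0_abs; last first.
  rewrite ceil_ge0 (lt_le_trans (ltrN10 _)) // mulr_ge0 //.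
  by have /andP[] := SN w.
by rewrite ceil_le_int /u ler_pdivlMr.
Qed.

Let c_max m w : (c m w <= N * m.+1)%N.
Proof. by rewrite c_le /u natrM mulfK //; have /andP[] := SN w. Qed.

Let u_ge0 m i : 0 <= u m i. Proof. by rewrite /u divr_ge0. Qed.

Let u_bnd m i : (i <= N * m.+1)%N -> 0 <= u m i <= u m (N * m.+1).
Proof. by move=> iN; rewrite u_ge0 ler_pM2r ?invr_gt0 // ler_nat. Qed.

Let F_c m i : brownian_filtration W (u m i) [set w | c m w = i].
Proof.
case: i => [|i].
  rewrite (_ : [set _ | _] = [set w | S w <= u m 0]); first exact: FS.
  by apply/seteqP; split=> w /=; rewrite -c_le leqn0 => /eqP.
rewrite (_ : [set _ | _] = [set w | S w <= u m i.+1] `\` [set w | S w <= u m i]).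
  rewrite setDE; apply: (@measurableI _ (g_sigma_algebraType _)).
    exact: FS.
  apply: (@measurableC _ (g_sigma_algebraType _)).
  by apply: brownian_filtration_le (FS (u_ge0 m i)); rewrite ler_pM2r ?invr_gt0 // ler_nat.
apply/seteqP; split=> w /=; rewrite -!c_le.
  by move=> ->; rewrite ltnn; split.
by move=> [ci /negP]; rewrite -ltnNge => ic; apply/eqP; rewrite eqn_leq ci.
Qed.

Let S_le m w : S w <= u m (c m w). Proof. by rewrite -c_le. Qed.

Let u_cvg w : u m (c m w) @[m --> \oo] --> S w.
Proof.
apply: (@squeeze_cvgr _ _ _ _ (cst (S w)) (fun m => S w + m.+1%:R^-1)).
- apply/nearW => m; rewrite /= S_le /= /u ler_pdivrMr // mulrDl mulVf //.
  rewrite /c natr_absz ger0_norm; last first.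
    rewrite ceil_ge0 (lt_le_trans (ltrN10 _)) // mulr_ge0 //.
    by have /andP[] := SN w.
  by have := ceilB1_lt (S w * m.+1%:R); rewrite intrB; lra.
- exact: cvg_cst.
- rewrite -[X in _ --> X]addr0; apply: cvgD; first exact: cvg_cst.
  exact: cvg_harmonic.
Qed.

Let W_cvg w : W (u m (c m w)) w @[m --> \oo] --> W (S w) w.
Proof.
have [_ Wc _ _] := hW.
apply: (within_continuous_cvg_seq (f := W ^~ w) (Wc w)) => //.
- by rewrite /= in_itv /= andbT; have /andP[] := SN w.
- by move=> m; rewrite /= in_itv /= andbT.
Qed.

Let mc m i : measurable [set w | c m w = i].
Proof. exact: brownian_filtration_measurable (@F_c m i). Qed.

Lemma measurable_stopping_time : measurable_fun setT S.
Proof.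
apply: (measurable_fun_cvg (h := fun m w => u m (c m w))) => [m|w _].
  apply: (@measurable_fun_select _ _ _ _ (c m) (fun i _ => u m i)) => //.
  exact: u_cvg.
Qed.

Lemma measurable_stopped_brownian : measurable_fun setT (fun w => W (S w) w).
Proof.
apply: (measurable_fun_cvg (h := fun m w => W (u m (c m w)) w)) => [m|w _].
  exact: (@measurable_fun_select _ _ _ _ (c m) (fun i => W (u m i))).
exact: W_cvg.
Qed.

Lemma measurable_stopped_exp_martingale a :
  measurable_fun setT (fun w => exp_martingale W a (S w) w).
Proof.
apply: measurableT_comp => //; apply: measurable_funB.
  by apply: measurable_funM => //; exact: measurable_stopped_brownian.
by apply: measurable_funM => //; exact: measurable_stopping_time.
Qed.

Let Z a m w := exp_martingale W a (u m (c m w)) w.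

Let mZ a m : measurable_fun setT (Z a m).
Proof.
apply: (@measurable_fun_select _ _ _ _ (c m)
  (fun i => exp_martingale W a (u m i))) => // i.
exact: measurable_exp_martingale.
Qed.

Let Z_ge0 a m w : 0 <= Z a m w. Proof. exact: expR_ge0. Qed.

Let EZ a m : (\int[P]_w (Z a m w)%:E = 1)%E.
Proof.
apply: (@expectation_exp_martingale_grid a (c m) (u m) (N * m.+1)%N) => //.
exact: u_bnd.
Qed.

Let Z_cvg a w : Z a m w @[m --> \oo] --> exp_martingale W a (S w) w.
Proof.
apply: (cvg_comp _ expR); last exact: continuous_expR.
apply: cvgB; apply: cvgM; first [exact: cvg_cst | exact: W_cvg | exact: u_cvg].
Qed.

(** Squaring doubles the parameter up to the factor [expR (a ^+ 2 * u)], with [u] the grid time,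
    which is at most [N]. As [Z (a *+ 2) m] has mean 1, this bounds the second moments uniformly in
    [m]. *)
Let Z_sqr a m w : Z a m w ^+ 2 <= expR (a ^+ 2 * N%:R) * Z (a *+ 2) m w.
Proof.
rewrite /Z /exp_martingale -expRM_natl -expRD ler_expR.
have uN : u m (c m w) <= N%:R.
  by have /andP[_] := u_bnd (c_max m w); rewrite /u natrM mulfK.
have := ler_wpM2l (sqr_ge0 a) uN.
rewrite -mulr_natr; lra.
Qed.

(** Limit of the grid approximations: Fatou gives [<= 1], and uniform integrability, by way of
    [Z_sqr], gives [>= 1]. *)
Lemma optional_stopping_exp a :
  (\int[P]_w (exp_martingale W a (S w) w)%:E = 1)%E.
Proof.
have mM := measurable_stopped_exp_martingale a.
have M0 w : 0 <= exp_martingale W a (S w) w by exact: expR_ge0.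
apply/eqP; rewrite eq_le; apply/andP; split.
  have fat := @fatou _ _ _ P setT measurableT (fun m w => (Z a m w)%:E).
  have -> : (1 = limn_einf (fun m => \int[P]_w (Z a m w)%:E))%E.
    under eq_fun do rewrite EZ.
    by rewrite (cvg_limn_einf_sup (cvg_cst _)).1.
  apply: le_trans (fat _ _) => //.
  - rewrite le_eqVlt; apply/orP; left; apply/eqP.
    apply: eq_integral => w _; apply/esym.
    have cv : (Z a m w)%:E @[m --> \oo] --> (exp_martingale W a (S w) w)%:E.
      by apply: cvg_EFin; [exact: nearW|exact: (@Z_cvg a w)].
    by rewrite is_cvg_limn_einfE; [exact/cvg_lim|apply/cvg_ex; eexists; exact: cv].
  - by move=> m; apply/measurable_EFinP.
  - by move=> m w _; rewrite lee_fin.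
(* The second moments of the discretised variables are bounded by [C], so that
   truncating at level [C / e] loses at most [e]. *)
apply/lee_addgt0Pr => e e0.
pose C := expR (a ^+ 2 * N%:R); pose L := C / e.
have C0 : 0 < C by exact: expR_gt0.
have L0 : 0 < L by rewrite divr_gt0.
have mmin m : measurable_fun setT (fun w => Num.min (Z a m w) L).
  by apply: measurable_minr.
have min0 m w : 0 <= Num.min (Z a m w) L by rewrite le_min Z_ge0 ltW.
have key m : (1 <= \int[P]_w (Num.min (Z a m w) L)%:E + e%:E)%E.
  have -> : e = C / L by rewrite /L invf_div mulrC divfK ?gt_eqF.
  rewrite -(EZ a m) EFinM.
  have -> : (C%:E * (L^-1)%:E = \int[P]_w (C / L * Z (a *+ 2) m w)%:E)%E.
    under eq_integral do rewrite EFinM.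
    rewrite ge0_integralZl_EFin //; last 3 first.
    - by move=> w _; rewrite lee_fin.
    - exact/measurable_EFinP.
    - by rewrite divr_ge0 // ltW.
    by rewrite EZ mule1 EFinM.
  rewrite -ge0_integralD //; last 4 first.
  - by move=> w _; rewrite lee_fin.
  - exact/measurable_EFinP.
  - by move=> w _; rewrite lee_fin mulr_ge0 // divr_ge0 // ltW.
  - by apply/measurable_EFinP; apply: measurable_funM.
  apply: ge0_le_integral => //.
  - by move=> w _; rewrite lee_fin.
  - exact/measurable_EFinP.
  - apply: emeasurable_funD; apply/measurable_EFinP => //.
    exact: measurable_funM.
  - move=> w _; rewrite -EFinD lee_fin.
    have [zL|Lz] := leP (Z a m w) L.
      by rewrite lerDl mulr_ge0 // divr_ge0 // ltW.
    (* Here [L < Z a m w], so that [Z a m w] is at most its square divided by [L]. *)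
    have : Z a m w <= C / L * Z (a *+ 2) m w.
      rewrite mulrAC ler_pdivlMr //; apply: le_trans (Z_sqr a m w).
      by rewrite expr2 ler_wpM2l // ltW.
    by move=> /le_trans; apply; rewrite lerDr ltW.
have mminS : measurable_fun setT (fun w => Num.min (exp_martingale W a (S w) w) L).
  exact: measurable_minr.
have lim : (\int[P]_w (Num.min (Z a m w) L)%:E)%E @[m --> \oo] -->
           (\int[P]_w (Num.min (exp_martingale W a (S w) w) L)%:E)%E.
  have [] := @dominated_convergence _ _ _ P setT measurableT
    (fun m w => (Num.min (Z a m w) L)%:E)
    (fun w => (Num.min (exp_martingale W a (S w) w) L)%:E) (cst L%:E) => //.
  - by move=> m; exact/measurable_EFinP.
  - exact/measurable_EFinP.
  - apply/aeW => w _; apply: cvg_EFin; first exact: nearW.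
    rewrite /= minr_absE; under eq_cvg do rewrite /= minr_absE.
    have cZ := @Z_cvg a w.
    apply: cvgM; last exact: cvg_cst.
    apply: cvgB; last apply: cvg_norm.
      by apply: cvgD; [exact: cZ|exact: cvg_cst].
    by apply: cvgB; [exact: cZ|exact: cvg_cst].
  - exact: finite_measure_integrable_cst.
  - apply/aeW => w m _; rewrite gee0_abs ?lee_fin //.
    by rewrite ge_min lexx orbT.
apply: (@le_trans _ _ (\int[P]_w (Num.min (exp_martingale W a (S w) w) L)%:E + e%:E)%E).
  have lim' : (\int[P]_w (Num.min (Z a m w) L)%:E + e%:E)%E @[m --> \oo] -->
           (\int[P]_w (Num.min (exp_martingale W a (S w) w) L)%:E + e%:E)%E.
    apply: cvgeD => //; last exact: cvg_cst.
    by rewrite fin_num_adde_defl.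
  rewrite -(cvg_lim _ lim') //; apply: lime_ge; last exact: nearW.
  by apply/cvg_ex; eexists; exact: lim'.
apply: leeD => //; apply: ge0_le_integral => //.
- by move=> w _; rewrite lee_fin le_min M0 ltW.
- exact/measurable_EFinP.
- exact/measurable_EFinP.
- by move=> w _; rewrite lee_fin ge_min lexx.
Qed.

End optional_stopping.

(** * Hitting times *)

Section hitting_time.
Context (R : realType) (T : Type) (Y : R -> T -> R).

Lemma hitting_time_ge0 (B : set R) w : (0 <= hitting_time Y B w)%E.
Proof. by apply/ereal_infP => _ [t [t0 _] <-]; rewrite lee_fin. Qed.

Lemma hitting_time_le (B : set R) t w :
  0 <= t -> B (Y t w) -> (hitting_time Y B w <= t%:E)%E.
Proof. by move=> t0 BY; apply: ereal_inf_lbound; exists t. Qed.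

Hypothesis Yc : forall w, {within `[0, +oo[, continuous (Y ^~ w)}.

(** By continuity the set of hits is closed, so a finite infimum is itself a hit. *)
Lemma hitting_time_attained t w :
  hitting_time Y [set y | 0 <= y] w = t%:E -> 0 <= Y t w.
Proof.
move=> ht; have t0 : 0 <= t by rewrite -lee_fin -ht hitting_time_ge0.
have near_hit n : exists s, [/\ 0 <= s, t <= s <= t + n.+1%:R^-1 & 0 <= Y s w].
  have : (hitting_time Y [set y | (0 <= y)%R] w < (t + n.+1%:R^-1)%:E)%E.
    by rewrite ht lte_fin ltrDl invr_gt0.
  move=> /ereal_inf_lt[_ [s [s0 Ys] <-]]; rewrite lte_fin => /ltW st.
  by exists s; split=> //; rewrite st andbT -lee_fin -ht hitting_time_le.
have [s sP] := choice near_hit.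
have st_cvg : s @ \oo --> t.
  apply: (@squeeze_cvgr _ _ _ _ (cst t) (fun m => t + m.+1%:R^-1)).
  - by apply/nearW => m; case: (sP m).
  - exact: cvg_cst.
  - rewrite -[X in _ --> X]addr0; apply: cvgD; first exact: cvg_cst.
    exact: cvg_harmonic.
have cv : Y (s n) w @[n --> \oo] --> Y t w.
  apply: (@within_continuous_cvg_seq _ (Y ^~ w) _ s t (@Yc w)) => //.
  - by rewrite /= in_itv /= andbT.
  - by move=> n; rewrite /= in_itv /= andbT; case: (sP n).
by apply: (cvgr_to_ge cv); apply/nearW => n; case: (sP n).
Qed.

Lemma hitting_time_leP t w :
  (hitting_time Y [set y | (0 <= y)%R] w <= t%:E)%E <->
  exists s, 0 <= s <= t /\ 0 <= Y s w.
Proof.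
split=> [|[s [/andP[s0 st] Ys]]]; last first.
  by apply: (@le_trans _ _ s%:E); [exact: hitting_time_le|rewrite lee_fin].
have := hitting_time_ge0 [set y | 0 <= y] w.
case: (hitting_time Y _ w) (@hitting_time_attained ^~ w) => [s| |] // + s0 st.
by move=> /(_ s erefl) Ys; exists s; rewrite -!lee_fin s0 st.
Qed.

(** A continuous path reaches [[0, +oo[] by time [t] exactly when it exceeds every [- n.+1%:R^-1] at
    some rational time clamped to [[0, t]]. This expresses the event by countably many values at
    times up to [t]. *)
Lemma hitting_time_le_rat t : 0 <= t ->
  [set w | (hitting_time Y [set y | (0 <= y)%R] w <= t%:E)%E] =
  \bigcap_n \bigcup_(q : rat)
    [set w | - n.+1%:R^-1 < Y (Num.min t (Num.max 0 (ratr q))) w].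
Proof.
move=> t0; apply/seteqP; split=> w /=.
- move=> /hitting_time_leP[s [/andP[s0 st] Ys]] n _.
  have /subspace_continuousP/(_ s) := @Yc w.
  rewrite /= in_itv /= andbT => /(_ s0)/cvgr_gt/(_ (- n.+1%:R^-1)).
  have n0 : - n.+1%:R^-1 < Y s w.
    by rewrite (lt_le_trans _ Ys) // oppr_lt0 invr_gt0.
  move=> /(_ n0) [e /= e0 near_s].
  have [q] := @rat_in_itvoo R (s - e) (s + e) ltac:(lra).
  rewrite in_itv /= => /andP[q1 q2]; exists q => //=.
  (* Since [s] lies in [[0, t]], clamping [q] to this interval brings it no further from [s]. *)
  apply: near_s.
    rewrite /ball /= ltr_norml; apply/andP.
    rewrite /Num.min /Num.max; case: ifPn; case: ifPn; rewrite -?leNgt => *; lra.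
  by rewrite in_itv /= andbT le_min t0 le_max lexx.
- move=> near0; apply/hitting_time_leP.
  have Yct : {within `[0, t], continuous (Y ^~ w)}.
    apply: continuous_subspaceW (@Yc w) => s /=.
    by rewrite !in_itv /= => /andP[->].
  (* The maximum over [[0, t]] exceeds every [- n.+1%:R^-1], hence is nonnegative. *)
  have [s] := EVT_max t0 Yct; rewrite in_itv /= => s0t maxs.
  exists s; split=> //; rewrite leNgt; apply/negP => Ys.
  have Ys' : 0 < - Y s w by rewrite oppr_gt0.
  have [n _] : exists2 n, True & n.+1%:R^-1 < - Y s w.
    have [n _ /(_ n (leqnn _))] := near_infty_natSinv_lt (PosNum Ys').
    by exists n.
  move=> nY; have [q _ /=] := near0 n I.
  apply/negP; rewrite -leNgt.
  apply: le_trans (maxs _ _) _; last by rewrite lerNr ltW.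
  by rewrite in_itv /= le_min t0 le_max lexx /= ge_min lexx.
Qed.

End hitting_time.

Lemma hitting_time_set (R : realType) (T : Type) (X Y : R -> T -> R)
    (A B : set R) w :
  (forall t, 0 <= t -> A (X t w) <-> B (Y t w)) ->
  hitting_time X A w = hitting_time Y B w.
Proof.
move=> AB; congr ereal_inf; apply/seteqP; split=> _ [t [t0 At] <-];
by exists t => //; split=> //; apply/AB.
Qed.

Section hitting_stopping_time.
Context (R : realType) (disp : measure_display) (T : measurableType disp).
Context (P : probability T R) (W : R -> {RV P >-> R}).
Hypothesis hW : brownian_motion W.

Lemma stopping_times_hitting_time (Y : R -> T -> R) :
  (forall w, {within `[0, +oo[, continuous (Y ^~ w)}) ->
  (forall s t, 0 <= s <= t -> measurable_fun setT
    (Y s : g_sigma_algebraType (natural_generators W t `|` null_sets P) -> R)) ->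
  stopping_times W (hitting_time Y [set y | 0 <= y]).
Proof.
move=> Yc mY; split=> [w|t t0]; first exact: hitting_time_ge0.
rewrite (hitting_time_le_rat Yc t0).
pose gF := g_sigma_algebraType (natural_generators W t `|` null_sets P).
apply: (@bigcapT_measurable _ gF) => n.
apply: (@bigcupT_measurable_rat _ gF) => q.
rewrite -[X in measurable X]setTI.
rewrite (_ : [set w | _] =
  Y (Num.min t (Num.max 0 (ratr q))) @^-1` `]- n.+1%:R^-1, +oo[).
  apply: (mY _ t) => //.
  by rewrite ge_min lexx andbT le_min t0 le_max lexx.
by apply/seteqP; split=> w /=; rewrite in_itv /= andbT.
Qed.

(** Truncation at [N] yields the bounded real-valued stopping times that optional stopping
    requires. *)
Lemma stopping_times_mine_nat (rho : T -> \bar R) (N : nat) :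
  stopping_times W rho ->
  [/\ forall w, 0 <= fine (mine (rho w) N%:R%:E) <= N%:R,
      forall w, (rho w <= N%:R%:E)%E ->
        (fine (mine (rho w) N%:R%:E))%:E = rho w,
      forall w, (N%:R%:E < rho w)%E -> fine (mine (rho w) N%:R%:E) = N%:R
    & forall t, 0 <= t -> brownian_filtration W t
        [set w | fine (mine (rho w) N%:R%:E) <= t]].
Proof.
move=> [rho0 Frho].
have E1 w : (rho w <= N%:R%:E)%E ->
    (fine (mine (rho w) N%:R%:E))%:E = rho w /\ fine (mine (rho w) N%:R%:E) <= N%:R.
  move=> rN; rewrite (min_idPl rN); move: (rho0 w) rN.
  by case: (rho w) => [r| |] //=; rewrite lee_fin.
have E2 w : (N%:R%:E < rho w)%E -> fine (mine (rho w) N%:R%:E) = N%:R.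
  by move=> rN; rewrite (min_idPr (ltW rN)).
have E3 w : 0 <= fine (mine (rho w) N%:R%:E) <= N%:R.
  have [rN|] := boolP (rho w <= N%:R%:E)%E; last rewrite -ltNge => rN.
  have [e eN] := E1 _ rN; apply/andP; split; last exact: eN.
    by rewrite -lee_fin e.
    by rewrite E2 // lexx ler0n.
split=> // [w /E1[]//|t t0].
have [tN|Nt] := ltP t N%:R.
  rewrite (_ : [set _ | _] = [set w | (rho w <= t%:E)%E]); first exact: Frho.
  apply/seteqP; split=> w /=.
    have [rN|] := boolP (rho w <= N%:R%:E)%E; last first.
      by rewrite -ltNge => rN; rewrite E2 // leNgt tN.
    by have [e _] := E1 _ rN; rewrite -lee_fin e.
  move=> rt; have rN : (rho w <= N%:R%:E)%E.
    by rewrite (le_trans rt) // lee_fin ltW.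
  by have [e _] := E1 _ rN; rewrite -lee_fin e.
rewrite (_ : [set _ | _] = setT); last first.
  apply/seteqP; split=> w //= _; apply: le_trans Nt.
  by have /andP[] := E3 w.
exact: (@measurableT _ (g_sigma_algebraType (natural_generators W t `|` null_sets P))).
Qed.

End hitting_stopping_time.

(** * Tangents of the payoff *)

Lemma is_derive_ge0_le (R : realType) (f df : R -> R) (a b : R) : a <= b ->
  (forall x : R, is_derive x (1 : R) f (df x)) ->
  (forall x, a <= x <= b -> 0 <= df x) -> f a <= f b.
Proof.
rewrite le_eqVlt => /predU1P[->//|ab] fdf df0.
have fc : {within `[a, b], continuous f}.
  by apply: derivable_within_continuous => x _; case: (fdf x).
have [c] := @MVT R f df a b ab (fun x _ => fdf x) fc.
rewrite in_itv /= => /andP[/ltW ac /ltW cb] fab.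
by rewrite -subr_ge0 fab mulr_ge0 ?df0 ?ac ?subr_ge0 // ltW.
Qed.

(* In logarithmic coordinates [t = ln y0], [s = ln y], [tangent t s] is the
   combination of [y `^ b] and [y `^ g] which touches [y - K] at [y0]. *)
Section tangent.
Context (R : realType) (K b g : R).
Hypotheses (K0 : 0 < K) (b1 : 1 < b) (g0 : g < 0) (bg : 1 <= b + g).

Ltac lra_hyps := move: K0 b1 g0 bg; lra.

(** The two coefficients solve the contact conditions [tangent_l t + tangent_r t = expR t - K] and
    [b * tangent_l t + g * tangent_r t = expR t]. *)
Definition tangent_l (t : R) := ((1 - g) * expR t + g * K) / (b - g).
Definition tangent_r (t : R) := ((b - 1) * expR t - b * K) / (b - g).

Definition tangent (t s : R) :=
  tangent_l t * expR (b * (s - t)) + tangent_r t * expR (g * (s - t)).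

Definition tangent_slope (t s : R) :=
  b * tangent_l t * expR (b * (s - t)) + g * tangent_r t * expR (g * (s - t)).

(** The common value of [b * tangent_l - tangent_l'] and [tangent_r' - g * tangent_r]: its sign
    decides the monotonicity of the tangents in the contact point. *)
Definition tangent_gap (t : R) :=
  ((b - 1) * (1 - g) * expR t + b * g * K) / (b - g).

Let bg0 : 0 < b - g. Proof. lra_hyps. Qed.
Let bg_neq0 : b - g != 0. Proof. by rewrite gt_eqF. Qed.

Lemma tangent_diag s : tangent s s = expR s - K.
Proof.
by rewrite /tangent /tangent_l /tangent_r subrr !mulr0 expR0; field.
Qed.

Lemma tangent_slope_diag s : tangent_slope s s = expR s.
Proof.
by rewrite /tangent_slope /tangent_l /tangent_r subrr !mulr0 expR0; field.
Qed.

Lemma tangent_gap_ge0 t : ln K <= t -> 0 <= tangent_gap t.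
Proof.
move=> Kt; have Ke : K <= expR t by rewrite -[K]lnK ?ler_expR ?posrE.
apply: divr_ge0; last exact: ltW.
(* In this form both summands are nonnegative, the second one by [bg]. *)
rewrite [leRHS](_ : _ = (b - 1) * (1 - g) * (expR t - K) + (b + g - 1) * K).
  by rewrite addr_ge0 ?mulr_ge0 //; lra_hyps.
by ring.
Qed.

Lemma is_derive_tangent s t : is_derive t (1 : R) (tangent ^~ s)
  (tangent_gap t * (expR (g * (s - t)) - expR (b * (s - t)))).
Proof.
apply: is_derive_eq; rewrite /GRing.scale /= /tangent_gap /tangent_l /tangent_r.
by field.
Qed.

Lemma is_derive_tangentN s t : is_derive t (1 : R) (fun t => - tangent t s)
  (- (tangent_gap t * (expR (g * (s - t)) - expR (b * (s - t))))).
Proof. by have := is_derive_tangent s t; apply: is_deriveN. Qed.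

Lemma tangent_le s t1 t2 : ln K <= t1 -> s <= t1 -> t1 <= t2 ->
  tangent t1 s <= tangent t2 s.
Proof.
move=> Kt1 st1 t12; apply: (is_derive_ge0_le t12 (is_derive_tangent s)) => t.
move=> /andP[t1t _]; rewrite mulr_ge0 //; first by apply: tangent_gap_ge0; lra_hyps.
rewrite subr_ge0 ler_expR -subr_ge0 -mulrBl mulr_le0 //; lra_hyps.
Qed.

Lemma tangent_ge s t1 t2 : ln K <= t1 -> t2 <= s -> t1 <= t2 ->
  tangent t2 s <= tangent t1 s.
Proof.
move=> Kt1 st2 t12; rewrite -lerN2.
apply: (is_derive_ge0_le t12 (is_derive_tangentN s)) => t /andP[t1t tt2].
rewrite oppr_ge0 mulr_ge0_le0 //; first by apply: tangent_gap_ge0; lra_hyps.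
rewrite subr_le0 ler_expR -subr_ge0 -mulrBl mulr_ge0 //; lra_hyps.
Qed.

(** The payoff at [s] is the value there of the tangent at [s]; by monotonicity, moving the contact
    point to either side only raises the value at [s]. *)
Lemma tangent_ge_payoff t s : ln K <= t -> ln K <= s ->
  expR s - K <= tangent t s.
Proof.
move=> Kt Ks; rewrite -tangent_diag.
have [st|/ltW ts] := leP s t; first exact: tangent_le.
exact: tangent_ge.
Qed.

(** At fixed [s] the slope is nonincreasing in the contact point, and it equals [expR s] when the
    contact point is [s]. *)
Lemma tangent_slope_le t s : ln K <= s -> s <= t -> tangent_slope t s <= expR s.
Proof.
move=> Ks st; rewrite -tangent_slope_diag -lerN2.
have D u : is_derive u (1 : R) (fun t => - tangent_slope t s)
    (- (tangent_gap u * (g * expR (g * (s - u)) - b * expR (b * (s - u))))).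
  apply: is_derive_eq; rewrite /GRing.scale /= /tangent_gap /tangent_l /tangent_r.
  by field.
apply: (is_derive_ge0_le st D) => u /andP[su ut].
rewrite oppr_ge0 mulr_ge0_le0 //; first by apply: tangent_gap_ge0; lra_hyps.
have := expR_gt0 (g * (s - u)); have := expR_gt0 (b * (s - u)).
by move=> e1 e2; rewrite subr_le0 (@le_trans _ _ 0) // ?nmulr_rle0 ?ltW // mulr_gt0 //; lra_hyps.
Qed.

(** By [tangent_slope_le] the payoff minus the tangent is nondecreasing from [ln K] on, where the
    payoff is 0. Once the tangent has value [delta] at [K], this bounds it by the cancellation
    payoff. *)
Lemma tangent_le_payoff t s : ln K <= s -> s <= t ->
  tangent t s <= expR s - K + tangent t (ln K).
Proof.
move=> Ks st.
have D u : is_derive u (1 : R) (fun u => expR u - tangent t u)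
    (expR u - tangent_slope t u).
  apply: is_derive_eq; rewrite /GRing.scale /= /tangent_slope /tangent_l /tangent_r.
  by field.
have : expR (ln K) - tangent t (ln K) <= expR s - tangent t s.
  apply: (is_derive_ge0_le Ks D) => u /andP[Ku us].
  by rewrite subr_ge0 tangent_slope_le //; lra_hyps.
by rewrite lnK ?posrE //; lra_hyps.
Qed.

Lemma continuous_tangent s : continuous (tangent ^~ s).
Proof.
move=> t; apply: differentiable_continuous; apply/derivable1_diffP.
by case: (is_derive_tangent s t).
Qed.

Lemma tangent_lnK : tangent (ln K) (ln K) = 0.
Proof. by rewrite tangent_diag lnK ?posrE // subrr. Qed.

Lemma tangent_l_ge0 t : ln K <= t -> 0 <= tangent_l t.
Proof.
move=> Kt; have Ke : K <= expR t by rewrite -[K]lnK ?ler_expR ?posrE.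
apply: divr_ge0; last exact: ltW.
have : 0 <= - g * (expR t - K) by rewrite mulr_ge0 //; lra_hyps.
have := expR_ge0 t; lra_hyps.
Qed.

(* Where the coefficient of [y `^ g] vanishes: the perpetual call boundary. *)
Let bd := b / (b - 1) * K.

Lemma tangent_r_le0 t : t <= ln bd -> tangent_r t <= 0.
Proof.
move=> tb; have bd0 : 0 < bd by rewrite !mulr_gt0 ?invr_gt0 //; lra_hyps.
have : expR t <= bd by rewrite -[bd]lnK ?ler_expR ?posrE.
have b10 : 0 < b - 1 by lra_hyps.
rewrite /bd mulrAC ler_pdivlMr // => H.
by rewrite /tangent_r pmulr_lle0 ?invr_gt0 //; lra_hyps.
Qed.

(** At [bd] only the power with exponent [b] survives: the tangent is the perpetual call value, and
    its value at [K] is [delta_star]. *)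
Lemma tangent_bd : tangent (ln bd) (ln K) = (bd - K) * expR (b * (ln K - ln bd)).
Proof.
have bd0 : 0 < bd by rewrite !mulr_gt0 ?invr_gt0 //; lra_hyps.
have b10 : b - 1 != 0 by rewrite gt_eqF //; lra_hyps.
have eb : expR (ln bd) = bd by rewrite lnK ?posrE.
rewrite /tangent /tangent_l /tangent_r eb.
rewrite [X in _ + X](_ : _ = 0) ?addr0; last by rewrite /bd; field; rewrite ?b10 ?bg_neq0.
by congr (_ * _); rewrite /bd; field; rewrite ?b10 ?bg_neq0.
Qed.

Lemma lnK_lt_bd : ln K < ln bd.
Proof.
have bd0 : 0 < bd by rewrite !mulr_gt0 ?invr_gt0 //; lra_hyps.
have b10 : 0 < b - 1 by lra_hyps.
rewrite ltr_ln ?posrE // /bd ltr_pMl // ltr_pdivlMr //; lra_hyps.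
Qed.

(** Intermediate values in the contact point: the tangent at [ln K] is 0 at the strike, and the one
    at [ln bd] is at least [delta] there. *)
Lemma exists_tangent_eq delta : 0 < delta ->
  delta <= (bd - K) * expR (b * (ln K - ln bd)) ->
  exists t, [/\ ln K < t, t <= ln bd & tangent t (ln K) = delta].
Proof.
move=> d0; rewrite -tangent_bd => dd.
have Kbd := ltW lnK_lt_bd.
have [||t] := @IVT R (tangent ^~ (ln K)) (ln K) (ln bd) delta Kbd.
- by apply: continuous_subspaceT => t; exact: continuous_tangent.
- have le0 : 0 <= tangent (ln bd) (ln K) := le_trans (ltW d0) dd.
  by rewrite tangent_lnK (min_idPl le0) (max_idPr le0) dd ltW.
rewrite in_itv /= => /andP[Kt tb] td; exists t; split=> //.
rewrite lt_neqAle Kt andbT; apply/eqP => tK.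
by move: d0; rewrite -td -tK tangent_lnK ltxx.
Qed.

End tangent.

(** * Powers, characteristic roots and the closed formulas *)

Lemma powR_expR (R : realType) (x p : R) : 0 < x -> x `^ p = expR (p * ln x).
Proof. by move=> x0; rewrite /powR gt_eqF. Qed.

Lemma powR_div_expR (R : realType) (x y p : R) : 0 < x -> 0 < y ->
  (x / y) `^ p = expR (p * (ln x - ln y)).
Proof. by move=> x0 y0; rewrite powR_expR ?divr_gt0 // ln_div. Qed.

Section exponents.
Context (R : realType) (r d sigma : R).
Hypotheses (hr : 0 < r) (hrd : r <= d) (hsigma : 0 < sigma).

Let drift := r - d - sigma ^+ 2 / 2.
Let a := lambda r d sigma / sigma.
Let kap := kappa r d sigma.

Definition beta := lambda r d sigma / sigma - kappa r d sigma.
Definition gamma := - (lambda r d sigma / sigma) - kappa r d sigma.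

Let s0 : sigma != 0. Proof. by rewrite gt_eqF. Qed.

Lemma lambda_gt0 : 0 < lambda r d sigma.
Proof. by rewrite sqrtr_gt0 ltr_wpDr ?sqr_ge0 ?mulr_gt0. Qed.

Let a0 : 0 < a. Proof. by rewrite divr_gt0 ?lambda_gt0. Qed.

Let kapE : kap = drift / sigma ^+ 2. Proof. by []. Qed.

Let a_sqr : a ^+ 2 = 2 * r / sigma ^+ 2 + kap ^+ 2.
Proof.
rewrite /a expr_div_n sqr_sqrtr ?addr_ge0 ?sqr_ge0 ?mulr_ge0 ?ltW //.
by rewrite kapE /drift; field.
Qed.

Lemma beta_root : sigma ^+ 2 / 2 * beta ^+ 2 + drift * beta = r.
Proof.
have dE : drift = kap * sigma ^+ 2 by rewrite kapE; field.
rewrite dE (_ : _ + _ = sigma ^+ 2 / 2 * (a ^+ 2 - kap ^+ 2)).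
  by rewrite a_sqr; field.
by rewrite /beta -/a -/kap; field.
Qed.

Lemma gamma_root : sigma ^+ 2 / 2 * gamma ^+ 2 + drift * gamma = r.
Proof.
have dE : drift = kap * sigma ^+ 2 by rewrite kapE; field.
rewrite dE (_ : _ + _ = sigma ^+ 2 / 2 * (a ^+ 2 - kap ^+ 2)).
  by rewrite a_sqr; field.
by rewrite /gamma -/a -/kap; field.
Qed.

Lemma beta_gt1 : 1 < beta.
Proof.
rewrite /beta -/a -/kap ltrBrDr.
have [k0|k0] := leP (1 + kap) 0; first exact: le_lt_trans k0 a0.
(* Squares are compared: [a ^+ 2 - (1 + kap) ^+ 2] equals [2 * d / sigma ^+ 2]. *)
rewrite -(@ltr_pXn2r _ 2) ?nnegrE ?ltW // a_sqr -subr_gt0.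
rewrite [ltRHS](_ : _ = 2 * d / sigma ^+ 2); last first.
  by rewrite kapE /drift; field.
by rewrite divr_gt0 ?exprn_gt0 // mulr_gt0 // (lt_le_trans hr).
Qed.

Lemma gamma_lt0 : gamma < 0.
Proof.
rewrite /gamma -/a -/kap; have [k0|k0] := leP 0 kap.
  by rewrite -opprD oppr_lt0 ltr_wpDr.
suff : - kap < a by rewrite subr_lt0 ltrNl.
rewrite -(@ltr_pXn2r _ 2) ?nnegrE ?ltW ?oppr_gt0 // a_sqr sqrrN ltrDr.
by rewrite divr_gt0 ?mulr_gt0 ?exprn_gt0.
Qed.

Lemma beta_gamma_ge1 : 1 <= beta + gamma.
Proof.
rewrite (_ : beta + gamma = 1 + 2 * (d - r) / sigma ^+ 2); last first.
  by rewrite /beta /gamma /kappa; field.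
by rewrite lerDl divr_ge0 ?sqr_ge0 // mulr_ge0 // subr_ge0.
Qed.

Variables (K : R).
Hypothesis K0 : 0 < K.

(** With [delta] replaced by the tangent's value at [K], the equation becomes a rational identity in
    [expR (beta * t)] and [expR (gamma * t)], where [t = ln k - ln K]. *)
Lemma kstar_equation_tangent (delta k : R) : 0 < k ->
  tangent K beta gamma (ln k) (ln K) = delta ->
  kstar_equation r d sigma K delta k.
Proof.
move=> k0 <-; rewrite /kstar_equation.
have lE : lambda r d sigma = a * sigma by rewrite /a divfK.
have aE : a = (beta - gamma) / 2 by rewrite /beta /gamma -/a; field.
have kE : kappa r d sigma = - (beta + gamma) / 2 by rewrite /beta /gamma; field.
have bg0 : beta - gamma != 0 by rewrite gt_eqF //; have := beta_gt1; have := gamma_lt0; lra.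
rewrite !powR_div_expR //.
set t := ln k - ln K.
have tN : ln K - ln k = - t by rewrite /t opprB.
rewrite !tN.
have e1 : expR (2 * lambda r d sigma / sigma * t) = expR (beta * t) / expR (gamma * t).
  by rewrite -expRN -expRD; congr expR; rewrite lE aE; field.
have e2 : expR (2 * lambda r d sigma / sigma * - t) = expR (gamma * t) / expR (beta * t).
  by rewrite -expRN -expRD; congr expR; rewrite lE aE; field.
have e3 : expR ((kappa r d sigma + lambda r d sigma / sigma) * - t) = expR (gamma * t).
  by congr expR; rewrite lE kE aE; field.
rewrite e1 e2 e3 /tangent /tangent_l /tangent_r tN !mulrN !expRN lnK ?posrE //.
have B0 : expR (beta * t) != 0 by rewrite gt_eqF ?expR_gt0.
have G0 : expR (gamma * t) != 0 by rewrite gt_eqF ?expR_gt0.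
rewrite lE kE aE.
by field; rewrite B0 G0 bg0.
Qed.

(** The closed formula interpolates the values [k - K] at [k] and [delta] at [K] by the two powers,
    and the tangent has these same values. *)
Lemma value_function_tangent (delta k x : R) : K < x -> x < k ->
  tangent K beta gamma (ln k) (ln K) = delta ->
  value_function r d sigma K delta k x = tangent K beta gamma (ln k) (ln x).
Proof.
move=> Kx xk <-; rewrite /value_function leNgt xk /= Kx.
have x0 : 0 < x by exact: lt_trans Kx.
have k0 : 0 < k by exact: lt_trans xk.
rewrite !powR_div_expR // -/a -/kap.
have -> : k - K = tangent_l K beta gamma (ln k) + tangent_r K beta gamma (ln k).
  rewrite /tangent_l /tangent_r lnK ?posrE //; field.
  by rewrite gt_eqF //; have := beta_gt1; have := gamma_lt0; lra.
rewrite /tangent; move: (tangent_l _ _ _ _) (tangent_r _ _ _ _) => A B.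
pose P := expR (kap * (ln k - ln K)); pose p := expR (kap * (ln x - ln K)).
pose Q := expR (a * (ln k - ln K)); pose q := expR (a * (ln x - ln K)).
have QE : expR (a * (ln k - ln K)) = Q by [].
have P0 : P != 0 by rewrite gt_eqF ?expR_gt0.
have p0 : p != 0 by rewrite gt_eqF ?expR_gt0.
have Q0 : Q != 0 by rewrite gt_eqF ?expR_gt0.
have q0 : q != 0 by rewrite gt_eqF ?expR_gt0.
have Q1 : 1 < Q.
  by rewrite -expR0 ltr_expR mulr_gt0 // subr_gt0 ltr_ln ?posrE // (lt_trans Kx).
(* The denominators of the closed formula are [Q - Q^-1]. *)
have QQ : Q * Q - 1 != 0.
  by rewrite gt_eqF // subr_gt0 -[ltLHS]mulr1 ltr_pM.
have e1 : expR (beta * (ln K - ln k)) = P / Q.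
  by rewrite -expRN -expRD; congr expR; rewrite /beta -/a -/kap; ring.
have e2 : expR (gamma * (ln K - ln k)) = P * Q.
  by rewrite -expRD; congr expR; rewrite /gamma -/a -/kap; ring.
have e3 : expR (beta * (ln x - ln k)) = P / Q * q / p.
  by rewrite -!expRN -!expRD; congr expR; rewrite /beta -/a -/kap; ring.
have e4 : expR (gamma * (ln x - ln k)) = P * Q / q / p.
  by rewrite -!expRN -!expRD; congr expR; rewrite /gamma -/a -/kap; ring.
have e5 : expR (kap * (ln k - ln x)) = P / p.
  by rewrite -!expRN -!expRD; congr expR; ring.
have e6 : expR (- a * (ln K - ln x)) = q by congr expR; ring.
have e7 : expR (a * (ln K - ln x)) = q^-1 by rewrite -expRN; congr expR; ring.
have e8 : expR (- a * (ln k - ln K)) = Q^-1 by rewrite -expRN; congr expR; ring.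
have e9 : expR (kap * (ln K - ln x)) = p^-1 by rewrite -expRN; congr expR; ring.
have e10 : expR (a * (ln k - ln x)) = Q / q.
  by rewrite -!expRN -!expRD; congr expR; ring.
have e11 : expR (- a * (ln k - ln x)) = q / Q.
  by rewrite -!expRN -!expRD; congr expR; ring.
rewrite e1 e2 e3 e4 e5 e6 e7 e8 e9 e10 e11 QE.
field.
by rewrite p0 q0 Q0 QQ.
Qed.

End exponents.

(** * Certificates for the two players *)

Section certificates.
Context (R : realType) (K b g delta : R).
Hypotheses (K0 : 0 < K) (b1 : 1 < b) (g0 : g < 0) (bg : 1 <= b + g).
Hypothesis delta0 : 0 < delta.

Definition powR2 (A B y : R) : R := A * y `^ b + B * y `^ g.

(* [f] dominates what the holder gets when the writer cancels at [K]. *)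
Definition holder_certificate (f : R -> R) (x : R) :=
  (x <= K /\ (forall y, 0 < y <= K -> 0 <= f y) \/
   K <= x /\ (forall y, K <= y -> y - K <= f y)) /\ delta <= f K.

(* [f] is dominated by what the writer pays when the holder waits for [k]. *)
Definition writer_certificate (f : R -> R) (k C : R) :=
  (forall y, 0 < y <= k -> f y <= call K y + delta /\ f y <= C) /\
  f k <= k - K.

Lemma tangent_powR2 t y : 0 < y ->
  powR2 (tangent_l K b g t * expR (- (b * t)))
        (tangent_r K b g t * expR (- (g * t))) y = tangent K b g t (ln y).
Proof.
move=> y0; rewrite /powR2 !powR_expR // /tangent -!mulrA -!expRD.
by congr (_ * (_ * expR _) + _ * (_ * expR _)); ring.
Qed.

Lemma powR2_scaled y : 0 < y -> powR2 (delta * expR (- (b * ln K))) 0 y =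
  delta * expR (b * (ln y - ln K)).
Proof.
move=> y0; rewrite /powR2 mul0r addr0 powR_expR // -mulrA -expRD.
by congr (_ * expR _); ring.
Qed.

Lemma holder_certificate_scaled x : x <= K ->
  holder_certificate (powR2 (delta * expR (- (b * ln K))) 0) x.
Proof.
move=> xK; split; last by rewrite powR2_scaled // subrr mulr0 expR0 mulr1.
left; split=> // y /andP[y0 _].
by rewrite powR2_scaled // mulr_ge0 ?expR_ge0 // ltW.
Qed.

(** The inequality at [K], rather than an equality, also admits contact points beyond the
    boundary. *)
Lemma holder_certificate_tangent t x : K <= x -> ln K <= t ->
  delta <= tangent K b g t (ln K) ->
  holder_certificate (powR2 (tangent_l K b g t * expR (- (b * t)))
                            (tangent_r K b g t * expR (- (g * t)))) x.
Proof.
move=> Kx Kt dt; split; last by rewrite tangent_powR2.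
right; split=> // y Ky; have y0 : 0 < y by exact: lt_le_trans Ky.
rewrite tangent_powR2 // -[X in X - K]lnK ?posrE //.
by apply: tangent_ge_payoff => //; rewrite ler_ln ?posrE.
Qed.

Section boundary.
Variable t : R.
Hypotheses (Kt : ln K < t) (tb : t <= ln (b / (b - 1) * K)).
Hypothesis td : tangent K b g t (ln K) = delta.

Let l0 : 0 <= tangent_l K b g t.
Proof. by apply: tangent_l_ge0 => //; exact: ltW. Qed.

Let r0 : tangent_r K b g t <= 0.
Proof. exact: tangent_r_le0. Qed.

(** Up to the call boundary the coefficients have the signs of their exponents, so both terms are
    nondecreasing. *)
Lemma tangent_le_mono s1 s2 : s1 <= s2 ->
  tangent K b g t s1 <= tangent K b g t s2.
Proof.
move=> s12; rewrite /tangent lerD //.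
  by rewrite ler_wpM2l // ler_expR ler_pM2l ?lerD2r // (lt_trans ltr01).
by rewrite ler_wnM2l // ler_expR ler_nM2l ?lerD2r.
Qed.

Lemma tangent_bound s : s <= t -> tangent K b g t s <= tangent_l K b g t.
Proof.
move=> st; rewrite /tangent -[leRHS]addr0 lerD //.
  rewrite -[leRHS]mulr1 ler_wpM2l // -expR0 ler_expR pmulr_rle0 ?subr_le0 //.
  exact: lt_trans ltr01 b1.
by rewrite mulr_le0_ge0 ?expR_ge0.
Qed.

(** Both sides agree at [K] and share the term in [tangent_l]. What remains is the nonpositive
    [tangent_r] times exponentials, and to the right of [ln K] the one with rate [b] outgrows the
    one with rate [g]. *)
Lemma scaled_le_tangent s : ln K <= s ->
  delta * expR (b * (s - ln K)) <= tangent K b g t s.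
Proof.
move=> Ks; have := r0; rewrite -td /tangent.
move: (tangent_l _ _ _ _) (tangent_r _ _ _ _) => L M M0.
rewrite mulrDl -!mulrA -!expRD.
rewrite (_ : b * (ln K - t) + b * (s - ln K) = b * (s - t)); last by ring.
rewrite lerD2l ler_wnM2l // ler_expR.
have : 0 <= (b - g) * (s - ln K).
  by rewrite mulr_ge0 ?subr_ge0 // ltW // (lt_trans g0) // (lt_trans ltr01).
by rewrite mulrBl !mulrBr; lra.
Qed.

(** Above [K] this is [tangent_le_payoff]; below [K] the tangent stays under its value [delta] at
    [K]. *)
Lemma tangent_le_cancel y : 0 < y <= expR t ->
  tangent K b g t (ln y) <= call K y + delta.
Proof.
move=> /andP[y0 yt]; have [Ky|yK] := leP K y.
  have := tangent_le_payoff K0 b1 g0 bg (s := ln y) (t := t).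
  rewrite !lnK ?posrE // td => /(_ _ _)/le_trans -> //.
  - by rewrite ler_ln ?posrE.
  - by rewrite -[t]expRK ler_ln ?posrE ?expR_gt0.
  - by rewrite lerD2r /call le_max lexx.
apply: (@le_trans _ _ delta).
  by rewrite -td tangent_le_mono // ler_ln ?posrE // ltW.
by rewrite lerDr /call le_max lexx orbT.
Qed.

Lemma writer_certificate_tangent :
  writer_certificate (powR2 (tangent_l K b g t * expR (- (b * t)))
     (tangent_r K b g t * expR (- (g * t)))) (expR t) (tangent_l K b g t).
Proof.
split=> [y yt|]; last by rewrite tangent_powR2 ?expR_gt0 // expRK tangent_diag.
have /andP[y0 yt'] := yt; rewrite tangent_powR2 //; split.
  exact: tangent_le_cancel.
by apply: tangent_bound; rewrite -[t]expRK ler_ln ?posrE ?expR_gt0.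
Qed.

Lemma writer_certificate_scaled :
  writer_certificate (powR2 (delta * expR (- (b * ln K))) 0) (expR t)
    (delta + tangent_l K b g t).
Proof.
split=> [y yt|]; last first.
  rewrite powR2_scaled ?expR_gt0 // expRK -(tangent_diag K0 b1 g0 bg).
  by rewrite scaled_le_tangent // ltW.
have /andP[y0 yt'] := yt; rewrite powR2_scaled //.
have [Ky|yK] := leP K y.
  have := scaled_le_tangent (s := ln y).
  rewrite ler_ln ?posrE // => /(_ Ky) sle.
  split; first exact: le_trans sle (tangent_le_cancel yt).
  apply: le_trans sle _; apply: le_trans (tangent_bound _) _.
    by rewrite -[t]expRK ler_ln ?posrE ?expR_gt0.
  by rewrite lerDr ltW.
have sle : delta * expR (b * (ln y - ln K)) <= delta.
  rewrite -[leRHS]mulr1 ler_pM2l // -expR0 ler_expR pmulr_rle0.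
    by rewrite subr_le0 ler_ln ?posrE // ltW.
  exact: lt_trans ltr01 b1.
split; apply: le_trans sle _; last by rewrite lerDl.
by rewrite lerDr /call le_max lexx orbT.
Qed.

End boundary.
End certificates.

(** [k] is [expR t] for the contact point [t] whose tangent is [delta] at [K]. The writer's
    certificate is asked for only at [x < k], because from [k] on the holder exercises at once. *)
Lemma exists_boundary (R : realType) (r d sigma K delta : R) :
  0 < r -> r <= d -> 0 < sigma -> 0 < K -> 0 < delta ->
  delta <= delta_star r d sigma K ->
  exists k, [/\ K < k, kstar_equation r d sigma K delta k &
    forall x, 0 < x ->
      (exists A B,
         powR2 (beta r d sigma) (gamma r d sigma) A B x =
           value_function r d sigma K delta k x /\
         holder_certificate K delta
           (powR2 (beta r d sigma) (gamma r d sigma) A B) x) /\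
      (x < k -> exists A B C,
         powR2 (beta r d sigma) (gamma r d sigma) A B x =
           value_function r d sigma K delta k x /\
         writer_certificate K delta
           (powR2 (beta r d sigma) (gamma r d sigma) A B) k C)].
Proof.
move=> r0 rd s0 K0 d0 ds.
have b1 := beta_gt1 r0 rd s0; have g0 := gamma_lt0 d r0 s0.
have bg := beta_gamma_ge1 rd s0.
set b := beta r d sigma in b1 bg *; set g := gamma r d sigma in g0 bg *.
have bd0 : 0 < b / (b - 1) * K.
  have b0 : 0 < b := lt_trans ltr01 b1.
  by rewrite mulr_gt0 // divr_gt0 // subr_gt0.
(* [delta_star] is the value at [K] of the tangent at the call boundary. *)
have [] := exists_tangent_eq K0 b1 g0 bg d0.
  by move: ds; rewrite /delta_star powR_div_expR.
move=> t [Kt tb td].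
have k0 : 0 < expR t := expR_gt0 t.
have Kk : K < expR t by rewrite -[K]lnK ?posrE // ltr_expR.
exists (expR t); split=> //.
  by apply: kstar_equation_tangent => //; rewrite expRK.
move=> x x0; have [xK|Kx] := leP x K.
  have E : powR2 b g (delta * expR (- (b * ln K))) 0 x =
      value_function r d sigma K delta (expR t) x.
    rewrite powR2_scaled // /value_function leNgt (le_lt_trans xK Kk) /=.
    by rewrite ltNge xK /= powR_div_expR.
  split=> [|_].
    do 2 eexists; split; first exact: E.
    exact: holder_certificate_scaled.
  do 3 eexists; split; first exact: E.
  exact: writer_certificate_scaled td.
have [kx|xk] := leP (expR t) x.
  split; last by [].
  (* The tangent at [x] takes the value [x - K] there, and at [K] it is at least the tangent at [k],
     that is [delta]. *)
  have Ktx : t <= ln x by rewrite -[t]expRK ler_ln ?posrE.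
  exists (tangent_l K b g (ln x) * expR (- (b * ln x))).
  exists (tangent_r K b g (ln x) * expR (- (g * ln x))).
  split.
    by rewrite tangent_powR2 // tangent_diag // lnK ?posrE // /value_function kx.
  apply: holder_certificate_tangent => //; first exact: ltW.
    by rewrite (le_trans (ltW Kt)).
  by rewrite -td; apply: tangent_le => //; exact: ltW.
have E : powR2 b g (tangent_l K b g t * expR (- (b * t)))
     (tangent_r K b g t * expR (- (g * t))) x =
      value_function r d sigma K delta (expR t) x.
  rewrite tangent_powR2 // (@value_function_tangent _ r d sigma) ?expRK //.
split=> [|_].
  do 2 eexists; split; first exact: E.
  by apply: holder_certificate_tangent; rewrite ?td // ltW.
do 3 eexists; split; first exact: E.
exact: writer_certificate_tangent.
Qed.

(** * Bounds on the game *)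

Section stock_process.
Context (R : realType) (disp : measure_display) (T : measurableType disp).
Context (P : probability T R) (W : R -> {RV P >-> R}) (r d sigma x : R).
Hypotheses (hW : brownian_motion W) (x0 : 0 < x).
Hypotheses (r0 : 0 < r) (s0 : 0 < sigma).

Local Notation X := (stock W r d sigma x).

Lemma stock_gt0 t w : 0 < X t w.
Proof. by rewrite mulr_gt0 ?expR_gt0. Qed.

Lemma continuous_stock w : {within `[0, +oo[, continuous (X ^~ w)}.
Proof.
have [_ Wc _ _] := hW; apply/subspace_continuousP => t t0.
have /subspace_continuousP/(_ t t0) Wt := Wc w.
apply: cvgM; first exact: cvg_cst.
apply: (cvg_comp _ expR); last exact: continuous_expR.
apply: cvgD; apply: cvgM; try exact: cvg_cst; last exact: Wt.
exact: cvg_within.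
Qed.

Lemma measurable_stock_filtration s t : 0 <= s <= t -> measurable_fun setT
  (X s : g_sigma_algebraType (natural_generators W t `|` null_sets P) -> R).
Proof.
move=> st; apply: measurable_funM => //; apply: measurableT_comp => //.
apply: measurable_funD => //; apply: measurable_funM => //.
exact: brownian_filtration_W.
Qed.

(** The characteristic equation makes the discount and the drift of the power combine to the
    compensator of the exponential martingale. *)
Lemma discounted_stock_powR p t w :
  sigma ^+ 2 / 2 * p ^+ 2 + (r - d - sigma ^+ 2 / 2) * p = r ->
  expR (- (r * t)) * X t w `^ p =
  x `^ p * exp_martingale W (p * sigma) t w.
Proof.
move=> rp; rewrite /stock powR_expR ?stock_gt0 //.
rewrite lnM ?posrE ?expR_gt0 // expRK powR_expR // -!expRD.
by congr expR; rewrite -[X in - (X * t)]rp; field.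
Qed.

Section stopped.
Variables (S : T -> R) (N : nat) (A B : R).
Hypothesis SN : forall w, 0 <= S w <= N%:R.
Hypothesis FS : forall t, 0 <= t -> brownian_filtration W t [set w | S w <= t].

Lemma measurable_stopped_stock : measurable_fun setT (fun w => X (S w) w).
Proof.
apply: measurable_funM => //; apply: measurableT_comp => //.
apply: measurable_funD; apply: measurable_funM => //.
  exact: measurable_stopping_time FS.
exact: measurable_stopped_brownian FS.
Qed.

(** Optional stopping for each root, then linearity; integrability is recorded because [A] and [B]
    may have either sign. *)
Lemma stopped_powR2 :
  P.-integrable setT (fun w => (expR (- (r * S w)) *
    powR2 (beta r d sigma) (gamma r d sigma) A B (X (S w) w))%:E) /\
  (\int[P]_w (expR (- (r * S w)) *
    powR2 (beta r d sigma) (gamma r d sigma) A B (X (S w) w))%:E =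
   (powR2 (beta r d sigma) (gamma r d sigma) A B x)%:E)%E.
Proof.
set b := beta r d sigma; set g := gamma r d sigma.
pose M p w := exp_martingale W (p * sigma) (S w) w.
have mM p : measurable_fun setT (M p).
  exact: (measurable_stopped_exp_martingale hW SN FS).
have EM p : (\int[P]_w (M p w)%:E = 1)%E.
  exact: (optional_stopping_exp hW SN FS).
have iM p : P.-integrable setT (EFin \o M p).
  apply/integrableP; split; first exact/measurable_EFinP.
  under eq_integral do rewrite /= ger0_norm ?expR_ge0 //.
  by rewrite EM ltry.
have E w : (expR (- (r * S w)) * powR2 b g A B (X (S w) w))%:E =
    ((A * x `^ b)%:E * (M b w)%:E + (B * x `^ g)%:E * (M g w)%:E)%E.
  rewrite -!EFinM -EFinD; congr EFin.
  rewrite /powR2 mulrDr !(mulrCA (expR _)).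
  rewrite (discounted_stock_powR _ _ (beta_root d r0 s0)).
  by rewrite (discounted_stock_powR _ _ (gamma_root d r0 s0)) !mulrA.
have i1 := integrableZl measurableT (A * x `^ b) (iM b).
have i2 := integrableZl measurableT (B * x `^ g) (iM g).
rewrite (funext E); split; first exact: integrableD i1 i2.
rewrite integralD // !integralZl //; try exact: iM.
have E1 p : (\int[P]_w (M p w)%:E)%E = 1%E by exact: EM.
by rewrite (E1 b) (E1 g) !mule1 -EFinD.
Qed.

End stopped.
End stock_process.

Section game.
Context (R : realType) (disp : measure_display) (T : measurableType disp).
Context (P : probability T R) (W : R -> {RV P >-> R}) (r d sigma K delta x : R).
Hypotheses (hW : brownian_motion W) (x0 : 0 < x).
Hypotheses (r0 : 0 < r) (s0 : 0 < sigma) (delta0 : 0 < delta).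

Local Notation X := (stock W r d sigma x).

Lemma stopping_times_mine (rho tau : T -> \bar R) :
  stopping_times W rho -> stopping_times W tau ->
  stopping_times W (fun w => mine (rho w) (tau w)).
Proof.
move=> [rho0 Frho] [tau0 Ftau]; split=> [w|t t0].
  by rewrite le_min rho0 tau0.
pose gF := g_sigma_algebraType (natural_generators W t `|` null_sets P).
have := @measurableU _ gF _ _ (Frho t t0) (Ftau t t0); congr measurable.
by apply/seteqP; split=> w /=; rewrite ge_min => /orP.
Qed.

Lemma measurable_stopping_times_le (rho : T -> \bar R) (t : R) :
  0 <= t -> stopping_times W rho -> measurable [set w | (rho w <= t%:E)%E].
Proof. by move=> t0 [_ Frho]; exact: brownian_filtration_measurable (Frho t t0). Qed.

Lemma measurable_stopping_times_lt (rho tau : T -> \bar R) :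
  stopping_times W rho -> stopping_times W tau ->
  measurable [set w | (tau w < rho w)%E].
Proof.
move=> srho stau.
(* A rational time separates [tau] from [rho]; the absolute value keeps it nonnegative, where the
   filtration condition applies. *)
rewrite (_ : [set _ | _] = \bigcup_(q : rat)
  ([set w | (tau w <= `|ratr q|%:E)%E] `\` [set w | (rho w <= `|ratr q|%:E)%E])).
  apply: bigcupT_measurable_rat => q.
  by apply: measurableD; exact: measurable_stopping_times_le.
apply/seteqP; split=> w /=.
  have [tau0 _] := stau; move: (tau0 w).
  case e : (tau w) => [t| |] //; last by move=> _; rewrite ltNge leey.
  rewrite lee_fin => t0 trho.
  have [u tu urho] : exists2 u : R, t < u & (u%:E <= rho w)%E.
    move: trho; case: (rho w) => [s| |] //= ts; first by exists s.
    by exists (t + 1); rewrite ?ltrDl ?leey.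
  have [q] := rat_in_itvoo tu; rewrite in_itv /= => /andP[tq qu].
  have q0 : 0 <= ratr q :> R by rewrite (le_trans t0) // ltW.
  exists q => //; rewrite /= e ger0_norm // lee_fin; split; first exact: ltW.
  by apply/negP; rewrite -ltNge; apply: lt_le_trans urho; rewrite lte_fin.
move=> [q _ [/= tq /negP]]; rewrite -ltNge; exact: le_lt_trans.
Qed.

Section payoff.
Variables rho tau : T -> \bar R.
Hypotheses (srho : stopping_times W rho) (stau : stopping_times W tau).

Local Notation payoff := (discounted_payoff W r d sigma K delta x rho tau).

Let theta w := mine (rho w) (tau w).
Let stheta : stopping_times W theta. Proof. exact: stopping_times_mine. Qed.

(** The clock time [t] is freed from [theta], while the order of [tau] and [rho] still selects the
    branch; so it can be evaluated at the bounded time [S n]. *)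
Definition payoff_at (t : R) (w : T) : R := expR (- (r * t)) *
  (if (tau w < rho w)%E then call K (X t w) + delta else call K (X t w)).

Let S n w := fine (mine (theta w) n%:R%:E).

Let S_bnd n w : 0 <= S n w <= n%:R.
Proof. by have [+ _ _ _] := stopping_times_mine_nat n stheta; apply. Qed.

Let S_small n w : (theta w <= n%:R%:E)%E -> (S n w)%:E = theta w.
Proof. by have [_ + _ _] := stopping_times_mine_nat n stheta; apply. Qed.

Let S_large n w : (n%:R%:E < theta w)%E -> S n w = n%:R.
Proof. by have [_ _ + _] := stopping_times_mine_nat n stheta; apply. Qed.

Let FS n t : 0 <= t -> brownian_filtration W t [set w | S n w <= t].
Proof. by have [_ _ _ +] := stopping_times_mine_nat n stheta; apply. Qed.

Lemma payoff_at_ge0 t w : 0 <= payoff_at t w.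
Proof.
have c0 : 0 <= call K (X t w) by rewrite /call le_max lexx orbT.
by rewrite mulr_ge0 ?expR_ge0 //; case: ifP => _ //; rewrite addr_ge0 // ltW.
Qed.

Lemma discounted_payoff_fin w t : theta w = t%:E -> payoff w = payoff_at t w.
Proof. by move=> e; rewrite /discounted_payoff -/(theta w) e. Qed.

Lemma discounted_payoff_infty w : theta w = +oo%E -> payoff w = 0.
Proof. by move=> e; rewrite /discounted_payoff -/(theta w) e. Qed.

Lemma discounted_payoff_ge0 w : 0 <= payoff w.
Proof.
rewrite /discounted_payoff; case: mine => [t| |] //; exact: payoff_at_ge0.
Qed.

(** The payoff counted only if the game ends by time [n]. It increases to the full payoff, which is
    0 where the game never ends. *)
Let trunc n w : R := \1_[set w | (theta w <= n%:R%:E)%E] w * payoff_at (S n w) w.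

Let truncE n w : trunc n w = if (theta w <= n%:R%:E)%E then payoff w else 0.
Proof.
rewrite /trunc indicE; have [tn|tn] := boolP (theta w <= n%:R%:E)%E.
  by rewrite mem_set // mul1r (discounted_payoff_fin (esym (S_small tn))).
by rewrite memNset ?mul0r //=; exact/negP.
Qed.

Let measurable_trunc n : measurable_fun setT (trunc n).
Proof.
apply: measurable_funM.
  by apply: measurable_indic; exact: measurable_stopping_times_le.
have mS : measurable_fun setT (S n).
  exact: (measurable_stopping_time (S_bnd n) (@FS n)).
have mX : measurable_fun setT (fun w => X (S n w) w).
  exact: (@measurable_stopped_stock _ _ _ _ _ r d sigma x hW (S n) n (S_bnd n) (@FS n)).
apply: measurable_funM.
  apply: measurableT_comp => //; apply: measurableT_comp => //.
  exact: measurable_funM.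
have mcall : measurable_fun setT (fun w => call K (X (S n w) w)).
  by apply: measurable_maxr => //; exact: measurable_funB.
apply: measurable_fun_ifT => //; last exact: measurable_funD.
apply: (measurable_fun_bool true).
by rewrite setTI; exact: measurable_stopping_times_lt.
Qed.

Let trunc_ge0 n w : 0 <= trunc n w.
Proof. by rewrite truncE; case: ifP => // _; exact: discounted_payoff_ge0. Qed.

Let trunc_nd w : {homo (fun n => (trunc n w)%:E) : n m / (n <= m)%N >-> (n <= m)%E}.
Proof.
move=> n m nm; rewrite lee_fin !truncE; case: ifPn => [tn|_].
  by rewrite ifT // (le_trans tn) // lee_fin ler_nat.
by case: ifP => // _; exact: discounted_payoff_ge0.
Qed.

Let trunc_cvg w : trunc n w @[n --> \oo] --> payoff w.
Proof.
have [theta0 _] := stheta.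
case e : (theta w) => [t| |]; last by move: (theta0 w); rewrite e.
  apply: cvg_near_cst; near=> n; rewrite truncE e lee_fin ifT //.
  by near: n; exact: nbhs_infty_ger.
by apply: cvg_near_cst; apply: nearW => n; rewrite truncE e discounted_payoff_infty.
Unshelve. all: by end_near. Qed.

Let measurable_payoff : measurable_fun setT payoff.
Proof. by apply: (measurable_fun_cvg measurable_trunc) => w _; exact: trunc_cvg. Qed.

Local Notation pw A B := (powR2 (beta r d sigma) (gamma r d sigma) A B).

Let stop_val A B n w := expR (- (r * S n w)) * pw A B (X (S n w) w).

(** At the bounded time [S n] the discounted combination dominates [trunc n], and its mean is the
    initial value; monotone convergence concludes. *)
Lemma J_le (A B : R) :
  (forall w t, theta w = t%:E ->
    payoff_at t w <= expR (- (r * t)) * pw A B (X t w)) ->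
  (forall w t, 0 <= t -> (t%:E < theta w)%E -> 0 <= pw A B (X t w)) ->
  (J W r d sigma K delta x rho tau <= (pw A B x)%:E)%E.
Proof.
move=> dom pos; rewrite /J unlock.
have cv := @cvg_monotone_convergence _ _ _ P setT measurableT
  (fun n w => (trunc n w)%:E) _ _ (fun w _ => @trunc_nd w).
have lim : (\int[P]_w (trunc n w)%:E)%E @[n --> \oo] --> (\int[P]_w (payoff w)%:E)%E.
  have -> : (\int[P]_w (payoff w)%:E = \int[P]_w limn (fun n => (trunc n w)%:E))%E.
    apply: eq_integral => w _; apply/esym/cvg_lim => //.
    by apply: cvg_EFin; [exact: nearW|exact: trunc_cvg].
  apply: cv.
  - by move=> n; exact/measurable_EFinP.
  - by move=> n w _; rewrite lee_fin.
have -> : (\int[P]_w (EFin \o payoff) w =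
    limn (fun n => \int[P]_w (trunc n w)%:E))%E by exact/esym/cvg_lim.
apply: lime_le; first by apply/cvg_ex; eexists; exact: lim.
apply: nearW => n.
have [iV EV] := stopped_powR2 d hW x0 r0 s0 A B (S_bnd n) (@FS n).
rewrite -EV; apply: ge0_le_integral => //.
- by move=> w _; rewrite lee_fin.
- exact/measurable_EFinP.
- exact: measurable_int iV.
move=> w _; rewrite lee_fin truncE; case: ifPn => [tn|].
  rewrite (discounted_payoff_fin (esym (S_small tn))); apply: dom.
  exact/esym/S_small.
rewrite -ltNge => nt; rewrite mulr_ge0 ?expR_ge0 //; apply: pos.
  by have /andP[] := S_bnd n w.
by rewrite S_large.
Qed.

(** At [S n] the discounted combination is at most the payoff plus [C' * expR (- (r * n%:R))], the
    second term covering the games still running at [n]. It vanishes in the limit because [r] is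
    positive. *)
Lemma J_ge (A B C : R) :
  (forall w t, theta w = t%:E ->
    expR (- (r * t)) * pw A B (X t w) <= payoff_at t w) ->
  (forall w t, 0 <= t -> (t%:E < theta w)%E -> pw A B (X t w) <= C) ->
  ((pw A B x)%:E <= J W r d sigma K delta x rho tau)%E.
Proof.
move=> dom bound; rewrite /J unlock.
pose C' := Num.max C 0; have C'0 : 0 <= C' by rewrite le_max lexx orbT.
have key n : ((pw A B x)%:E <=
    \int[P]_w (payoff w)%:E + (C' * expR (- (r * n%:R)))%:E)%E.
  have [iV EV] := stopped_powR2 d hW x0 r0 s0 A B (S_bnd n) (@FS n).
  have c0 : 0 <= C' * expR (- (r * n%:R)) by rewrite mulr_ge0 ?expR_ge0.
  have -> : (\int[P]_w (payoff w)%:E + (C' * expR (- (r * n%:R)))%:E =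
     \int[P]_w ((payoff w)%:E + (C' * expR (- (r * n%:R)))%:E))%E.
    rewrite ge0_integralD //.
    - rewrite integral_cst //; congr (_ + _)%E; rewrite -[LHS]mule1; congr (_ * _)%E.
      exact/esym/probability_setT.
    - by move=> w _; rewrite lee_fin discounted_payoff_ge0.
    - exact/measurable_EFinP.
  (* The combination may be negative, so its positive part is compared with the payoff. *)
  rewrite -EV integralE; apply: (@le_trans _ _ (\int[P]_w
    ((fun w => (stop_val A B n w)%:E)^\+ w))%E).
    rewrite -[leRHS]sube0; apply: leeB => //; apply: integral_ge0 => w _.
    exact: funeneg_ge0.
  apply: ge0_le_integral => //.
  - exact/measurable_funepos/(measurable_int _ iV).
  - by apply: emeasurable_funD => //; exact/measurable_EFinP.
  move=> w _; rewrite funeposE ge_max; apply/andP; split; last first.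
    by rewrite -EFinD lee_fin addr_ge0 // discounted_payoff_ge0.
  rewrite -EFinD lee_fin; have [tn|] := boolP (theta w <= n%:R%:E)%E.
    rewrite (discounted_payoff_fin (esym (S_small tn))).
    apply: le_trans (dom _ _ _) _; first exact/esym/S_small.
    by rewrite lerDl.
  rewrite -ltNge => nt; rewrite /stop_val S_large //.
  apply: (@le_trans _ _ (C' * expR (- (r * n%:R)))); last first.
    by rewrite lerDr discounted_payoff_ge0.
  rewrite mulrC ler_wpM2r ?expR_ge0 // (le_trans (bound _ _ _ _)) ?le_max ?lexx //.
have lim : ((\int[P]_w (payoff w)%:E + (C' * expR (- (r * n%:R)))%:E)%E
    @[n --> \oo] --> (\int[P]_w (payoff w)%:E + 0)%E).
  apply: cvgeD; [by rewrite fin_num_adde_defl|exact: cvg_cst|].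
  apply: cvg_EFin; first exact: nearW.
  rewrite -[X in _ --> X](mulr0 C'); apply: cvgM; first exact: cvg_cst.
  apply: (cvg_comp (fun n : nat => r * n%:R) (fun y => expR (- y)) _ (@cvgr_expR R)).
  have /cvgryPge idn := @cvgr_idn R.
  by apply/cvgryPge => M; apply: filterS (idn (M / r)) => n; rewrite ler_pdivrMr // mulrC.
rewrite -[leRHS]adde0 -(cvg_lim _ lim) //; apply: lime_ge.
  by apply/cvg_ex; eexists; exact: lim.
exact: nearW.
Qed.

End payoff.
End game.

(** * Hitting times of the stock price *)

Section hitting_stock.
Context (R : realType) (disp : measure_display) (T : measurableType disp).
Context (P : probability T R) (W : R -> {RV P >-> R}) (r d sigma x : R).
Hypotheses (hW : brownian_motion W).

Local Notation X := (stock W r d sigma x).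

Lemma stock0 w : X 0 w = x.
Proof. by have [W0 _ _ _] := hW; rewrite /stock W0 !mulr0 addr0 expR0 mulr1. Qed.

Let Xc w : {within `[0, +oo[, continuous (X ^~ w)}.
Proof. exact: (continuous_stock hW). Qed.

Let hits_value (c t : R) w : 0 <= t ->
  Num.min x (X t w) <= c <= Num.max x (X t w) ->
  exists2 s, 0 <= s <= t & X s w = c.
Proof.
move=> t0 ct; have Xct : {within `[0, t], continuous (X ^~ w)}.
  by apply: continuous_subspaceW (@Xc w) => s /=; rewrite !in_itv /= => /andP[->].
have [|s] := @IVT R (X ^~ w) 0 t c t0 Xct; first by rewrite stock0.
by rewrite in_itv /= => st Xs; exists s.
Qed.

(** A path starting below [c] must pass through [c] to exceed it. Any [B] containing [c] is allowed,
    which serves the hitting times of both players. *)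
Lemma stock_le_until_hitting (B : set R) (c t : R) w : B c -> x <= c -> 0 <= t ->
  (t%:E <= hitting_time X B w)%E -> X t w <= c.
Proof.
move=> Bc xc t0 th; rewrite leNgt; apply/negP => cX.
have [|s /andP[s0 st] Xs] := @hits_value c t w t0.
  by rewrite ge_min xc le_max (ltW cX) orbT.
have : (hitting_time X B w <= s%:E)%E by apply: hitting_time_le; rewrite ?Xs.
move=> /(le_trans th); rewrite lee_fin => ts.
by move: cX; rewrite (le_anti (introT andP (conj ts st))) Xs ltxx.
Qed.

Lemma stock_ge_until_hitting (B : set R) (c t : R) w : B c -> c <= x -> 0 <= t ->
  (t%:E <= hitting_time X B w)%E -> c <= X t w.
Proof.
move=> Bc cx t0 th; rewrite leNgt; apply/negP => Xcc.
have [|s /andP[s0 st] Xs] := @hits_value c t w t0.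
  by rewrite ge_min (ltW Xcc) orbT le_max cx.
have : (hitting_time X B w <= s%:E)%E by apply: hitting_time_le; rewrite ?Xs.
move=> /(le_trans th); rewrite lee_fin => ts.
by move: Xcc; rewrite (le_anti (introT andP (conj ts st))) Xs ltxx.
Qed.

Section level.
Variable c : R.

(** Both hitting times become first entries of a continuous process into [[0, +oo[]; [Y2] is
    nonnegative only where the price equals [c]. *)
Let Y1 t w := X t w - c.
Let Y2 t w := - `|X t w - c|.

Let Y1c w : {within `[0, +oo[, continuous (Y1 ^~ w)}.
Proof.
apply/subspace_continuousP => t t0; have /subspace_continuousP/(_ t t0) Xt := @Xc w.
by apply: cvgB; [exact: Xt|exact: cvg_cst].
Qed.

Let Y2c w : {within `[0, +oo[, continuous (Y2 ^~ w)}.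
Proof.
apply/subspace_continuousP => t t0; have /subspace_continuousP/(_ t t0) Xt := @Xc w.
apply: cvgN; apply: cvg_norm.
by apply: cvgB; [exact: Xt|exact: cvg_cst].
Qed.

Lemma hitting_time_above :
  hitting_time X [set y | c <= y] = hitting_time Y1 [set y | 0 <= y].
Proof.
by apply/funext => w; apply: hitting_time_set => t _ /=; rewrite /Y1 subr_ge0.
Qed.

Lemma hitting_time_level :
  hitting_time X [set c] = hitting_time Y2 [set y | 0 <= y].
Proof.
apply/funext => w; apply: hitting_time_set => t _ /=.
rewrite /Y2 oppr_ge0 normr_le0 subr_eq0.
by split=> [->|/eqP].
Qed.

Lemma hitting_time_above_attained t w :
  hitting_time X [set y | c <= y] w = t%:E -> c <= X t w.
Proof.
rewrite hitting_time_above => /(hitting_time_attained Y1c).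
by rewrite /Y1 subr_ge0.
Qed.

Lemma hitting_time_level_attained t w :
  hitting_time X [set c] w = t%:E -> X t w = c.
Proof.
rewrite hitting_time_level => /(hitting_time_attained Y2c).
by rewrite /Y2 oppr_ge0 normr_le0 subr_eq0 => /eqP.
Qed.

Lemma stopping_times_above : stopping_times W (hitting_time X [set y | c <= y]).
Proof.
rewrite hitting_time_above; apply: (stopping_times_hitting_time Y1c) => s t st.
apply: measurable_funB => //; exact: measurable_stock_filtration.
Qed.

Lemma stopping_times_level : stopping_times W (hitting_time X [set c]).
Proof.
rewrite hitting_time_level; apply: (stopping_times_hitting_time Y2c) => s t st.
apply: measurableT_comp => //; apply: measurableT_comp => //.
apply: measurable_funB => //; exact: measurable_stock_filtration.
Qed.

End level.
End hitting_stock.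

(** * The saddle point *)

Section saddle_point.
Context (R : realType) (disp : measure_display) (T : measurableType disp).
Context (P : probability T R) (W : R -> {RV P >-> R}) (r d sigma K delta x : R).
Hypotheses (hW : brownian_motion W) (x0 : 0 < x).
Hypotheses (r0 : 0 < r) (s0 : 0 < sigma) (delta0 : 0 < delta).

Local Notation X := (stock W r d sigma x).
Local Notation pw A B := (powR2 (beta r d sigma) (gamma r d sigma) A B).

Lemma J_hitting_strike_le (A B : R) (rho : T -> \bar R) :
  holder_certificate K delta (pw A B) x -> stopping_times W rho ->
  (J W r d sigma K delta x rho (hitting_time X [set K]) <= (pw A B x)%:E)%E.
Proof.
move=> [cert fK] srho; have stau := stopping_times_level r d sigma x hW K.
have Xgt0 t w : 0 < X t w by exact: stock_gt0.
(* Until it reaches [K] the price stays on the side where it started, which is the side covered by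
   the certificate. *)
have region t w : 0 <= t -> (t%:E <= hitting_time X [set K] w)%E ->
    0 <= pw A B (X t w) /\ call K (X t w) <= pw A B (X t w).
  move=> t0 th; case: cert => [[xK fpos]|[Kx fK']].
    have XK := stock_le_until_hitting hW (erefl K : [set K] K) xK t0 th.
    have f0 : 0 <= pw A B (X t w) by apply: fpos; rewrite Xgt0.
    by split=> //; rewrite /call ge_max f0 andbT (le_trans _ f0) // subr_le0.
  have XK := stock_ge_until_hitting hW (erefl K : [set K] K) Kx t0 th.
  have fX := fK' _ XK; have f0 : 0 <= pw A B (X t w).
    by rewrite (le_trans _ fX) // subr_ge0.
  by split=> //; rewrite /call ge_max f0 andbT.
apply: J_le => // [w t e|w t t0]; last first.
  by rewrite lt_min => /andP[_ /ltW /(region t w t0)[]].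
have t0 : 0 <= t.
  have := (stopping_times_mine srho stau).1 w; by rewrite e lee_fin.
have th : (t%:E <= hitting_time X [set K] w)%E by rewrite -e ge_min lexx orbT.
(* Cancellation occurs at price [K], where the call pays 0 and only [delta] is due. *)
rewrite /payoff_at ler_wpM2l ?expR_ge0 //; case: ifPn => [tr|_].
  have : hitting_time X [set K] w = t%:E by rewrite -e (min_idPr (ltW tr)).
  move=> /(hitting_time_level_attained hW) ->.
  by rewrite /call subrr maxxx add0r.
by have [] := region t w t0 th.
Qed.

Lemma J_hitting_boundary_ge (k A B C : R) (tau : T -> \bar R) :
  K < k -> x < k -> writer_certificate K delta (pw A B) k C ->
  stopping_times W tau ->
  ((pw A B x)%:E <=
     J W r d sigma K delta x (hitting_time X [set y | (k <= y)%R]) tau)%E.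
Proof.
move=> Kk xk [cert fk] stau; have srho := stopping_times_above r d sigma x hW k.
have Xgt0 t w : 0 < X t w by exact: stock_gt0.
have region t w : 0 <= t -> (t%:E <= hitting_time X [set y | (k <= y)%R] w)%E ->
    0 < X t w <= k.
  move=> t0 th; rewrite Xgt0.
  by apply: (stock_le_until_hitting hW _ (ltW xk) t0 th) => /=.
apply: (@J_ge _ _ _ _ _ _ _ _ _ _ _ hW x0 r0 s0 delta0 _ _ srho stau A B C)
  => [w t e|w t t0]; last first.
  by rewrite lt_min => /andP[/ltW /(region t w t0)/cert[]].
have t0 : 0 <= t.
  have := (stopping_times_mine srho stau).1 w; by rewrite e lee_fin.
have th : (t%:E <= hitting_time X [set y | (k <= y)%R] w)%E.
  by rewrite -e ge_min lexx.
rewrite /payoff_at ler_wpM2l ?expR_ge0 //; case: ifPn => [_|].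
  by have [] := cert _ (region t w t0 th).
(* By continuity a holder who waits for [k] exercises at price exactly [k]. *)
rewrite -leNgt => rt.
have /(hitting_time_above_attained hW) kX :
    hitting_time X [set y | k <= y] w = t%:E by rewrite -e (min_idPl rt).
have -> : X t w = k.
  by apply/le_anti; rewrite kX andbT; have /andP[] := region t w t0 th.
by apply: le_trans fk _; rewrite /call le_max lexx.
Qed.

(** The hitting time is 0 and ties count as exercise, so the writer cannot interfere. *)
Lemma J_immediate_exercise (k : R) (tau : T -> \bar R) :
  K < k -> k <= x -> stopping_times W tau ->
  J W r d sigma K delta x (hitting_time X [set y | k <= y]) tau = (x - K)%:E.
Proof.
move=> Kk kx [tau0 _].
have rho0 w : hitting_time X [set y | k <= y] w = 0%:E.
  apply/eqP; rewrite eq_le hitting_time_ge0 andbT.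
  by apply: hitting_time_le; rewrite // stock0.
rewrite /J -(expectation_cst P (x - K)); congr expectation; apply/funext => w.
rewrite /discounted_payoff rho0 (min_idPl (tau0 w)) ltNge tau0 /=.
rewrite mulr0 oppr0 expR0 mul1r stock0 // /call (max_idPl _) // subr_ge0.
by rewrite (le_trans (ltW Kk)).
Qed.

End saddle_point.

Theorem theorem3p1 (R : realType) (disp : measure_display)
    (T : measurableType disp) (P : probability T R) (W : R -> {RV P >-> R})
    (r d sigma K delta : R)
    (hW : brownian_motion W)
    (hr : 0 < r) (hrd : r <= d) (hsigma : 0 < sigma) (hK : 0 < K)
    (hdelta : 0 < delta) (hdelta_star : delta <= delta_star r d sigma K) :
  exists k : R,
    [/\ K < k,
        kstar_equation r d sigma K delta k,
        forall x : R, 0 < x ->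
          upper_value W r d sigma K delta x
            = (value_function r d sigma K delta k x)%:E /\
          lower_value W r d sigma K delta x
            = (value_function r d sigma K delta k x)%:E
      & optimal_strategies W r d sigma K delta
          (fun x => hitting_time (stock W r d sigma x) [set y | k <= y])
          (fun x => hitting_time (stock W r d sigma x) [set K])].
Proof.
have [k [Kk keq cert]] := exists_boundary hr hrd hsigma hK hdelta hdelta_star.
pose V x := (value_function r d sigma K delta k x)%:E.
pose rho0 x := hitting_time (stock W r d sigma x) [set y | k <= y].
pose tau0 x := hitting_time (stock W r d sigma x) [set K].
have srho0 x : stopping_times W (rho0 x) by exact: stopping_times_above.
have stau0 x : stopping_times W (tau0 x) by exact: stopping_times_level.
(* [Jle] and [Jge] bracket [V x] whatever the opponent does; the saddle point and both game values
   follow from them. *)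
have Jle x rho : 0 < x -> stopping_times W rho ->
    (J W r d sigma K delta x rho (tau0 x) <= V x)%E.
  move=> x0 srho; have [[A [B [E hc]]] _] := cert x x0.
  rewrite /V -E.
  exact: J_hitting_strike_le.
have Jge x tau : 0 < x -> stopping_times W tau ->
    (V x <= J W r d sigma K delta x (rho0 x) tau)%E.
  move=> x0 stau; have [kx|xk] := leP k x.
    by rewrite J_immediate_exercise // /V /value_function kx.
  have [_ /(_ xk)[A [B [C [E wc]]]]] := cert x x0.
  rewrite /V -E.
  exact: J_hitting_boundary_ge wc stau.
exists k; split=> //; last first.
  move=> x x0; split; [exact: srho0|exact: stau0|move=> rho tau srho stau; split].
    exact: le_trans (Jle _ _ x0 srho) (Jge _ _ x0 (stau0 x)).
  exact: le_trans (Jle _ _ x0 (srho0 x)) (Jge _ _ x0 stau).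
move=> x x0.
have upper : (upper_value W r d sigma K delta x <= V x)%E.
  apply: ge_ereal_inf; exists (ereal_sup [set J W r d sigma K delta x rho (tau0 x)
    | rho in stopping_times W]); first by exists (tau0 x).
  by apply/ereal_supP => _ [rho srho <-]; exact: Jle.
have lower : (V x <= lower_value W r d sigma K delta x)%E.
  apply: le_ereal_sup_tmp; exists (ereal_inf [set J W r d sigma K delta x (rho0 x) tau
    | tau in stopping_times W]); first by exists (rho0 x).
  by apply/ereal_infP => _ [tau stau <-]; exact: Jge.
(* Weak duality closes the chain [V x <= lower_value <= upper_value <= V x]. *)
have minimax : (lower_value W r d sigma K delta x <=
                upper_value W r d sigma K delta x)%E.
  apply/ereal_supP => _ [rho srho <-]; apply/ereal_infP => _ [tau stau <-].
  apply: (@le_trans _ _ (J W r d sigma K delta x rho tau)).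
    by apply: ereal_inf_lbound; exists tau.
  by apply: ereal_sup_ubound; exists rho.
split; apply/le_anti/andP; split=> //.
  exact: le_trans minimax.
exact: le_trans upper.
Qed.
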